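(* Let $(\mathbb{A},+)$ be a finite Abelian group with $|\mathbb{A}|\ge 2$. For each $0<\varepsilon<\frac{|\mathbb{A}|-1}{|\mathbb{A}|}$, the filtration $\mathscr{F}^{\tau_\varepsilon}$ generated by the negative-time part of the stationary Markov chain of the probabilistic cellular automaton $\tau_\varepsilon$ is I-cosy, hence it is standard.
   Context: Conventions: probability spaces are Polish spaces with their Borel $\sigma$-algebra; random variables take values in Polish spaces; $\mathcal{L}(X)$ is the law of $X$. $\Sigma(X_m:m\in I)$ denotes the $\sigma$-algebra generated by the $X_m$, $m\in I$, and the negligible sets; all $\sigma$-algebras are complete and essentially separable. A filtration is a non-decreasing sequence $\mathscr{F}=(\mathscr{F}_n)_{n\le 0}$ of sub-$\sigma$-algebras on a probability space; it is generated by $(X_n)_{n\le0}$ if $\mathscr{F}_n=\Sigma(X_m:m\le n)$ for all $n\le 0$. Classification notions: Two filtrations $\mathscr{F},\mathscr{F}'$ (possibly on different probability spaces) are isomorphic, $\mathscr{F}\sim\mathscr{F}'$, if there are processes $X,X'$ with the same law generating $\mathscr{F}$ and $\mathscr{F}'$ respectively. Given such $X,X'$ and an $\mathscr{F}_0$-measurable random variable $Y=\phi(X)$ a.s., the copy of $Y$ in $\mathscr{F}'$ is $Y'=\phi(X')$. For filtrations on the same space, $\mathscr{F}$ is immersed in $\mathscr{G}$ if $\mathscr{F}_n\subset\mathscr{G}_n$ for all $n\le0$ and, for all $n\le-1$, $\mathscr{F}_{n+1}$ and $\mathscr{G}_n$ are independent conditionally to $\mathscr{F}_n$; $\mathscr{F}$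 and $\mathscr{G}$ are jointly immersed if both are immersed in $\mathscr{F}\vee\mathscr{G}$. $\mathscr{F}$ is immersible in $\mathscr{G}$ if some filtration isomorphic to $\mathscr{F}$ is immersed in $\mathscr{G}$. A filtration is of product type if it can be generated by a process formed of independent random variables; it is standard if it is immersible in a filtration of product type. A real-time coupling of $\mathscr{F}$ is a pair $(\mathscr{F}',\mathscr{F}'')$ of filtrations on a common probability space (possibly different from the original) with $\mathscr{F}'\sim\mathscr{F}$, $\mathscr{F}''\sim\mathscr{F}$, and $\mathscr{F}',\mathscr{F}''$ jointly immersed; it is independent in the distant past if $\mathscr{F}'_{n_0}$ and $\mathscr{F}''_{n_0}$ are independent for some integer $n_0\le 0$. An $\mathscr{F}_0$-measurable random variable $Y$ with values in a Polish metric space $(E,d)$ is I-cosy if for each $\delta>0$ there is a real-time coupling of $\mathscr{F}$, independent in the distant past, such that the copies $Y',Y''$ of $Y$ in $\mathscr{F}',\mathscr{F}''$ satisfy $d(Y',Y'')<\delta$ with probability $>1-\delta$. $\mathscr{F}$ is I-cosy if every $\mathscr{F}_0$-measurable random variable (with values in a Polish metric space) is I-cosy. Construction of $\mathscr{F}^{\tau_\varepsilon}$: $\tau:\mathbb{A}^{\mathbb{Z}}\to\mathbb{A}^{\mathbb{Z}}$, $\tau x(i)=x(i)+x(i+1)$. $\tau_\varepsilon$ is the Markov kernel on $\mathbb{A}^{\mathbb{Z}}$ for which $\tau_\varepsilon(x,\cdot)$ is the law of $\tau x+\xi$, where $\xi=(\xi(i))_{i\in\mathbb{Z}}$ has i.i.d.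 coordinates with $\xi(i)=0_{\mathbb{A}}$ with probability $1-\varepsilon$ and $\xi(i)=a$ with probability $\frac{\varepsilon}{|\mathbb{A}|-1}$ for each $a\ne0_{\mathbb{A}}$. Let $\mu$ be the product measure on $\mathbb{A}^{\mathbb{Z}}$ with uniform marginals; it is $\tau_\varepsilon$-invariant. Let $(X_n)_{n\in\mathbb{Z}}$ be a stationary Markov chain with $\mathcal{L}(X_n)=\mu$ and $\mathcal{L}(X_{n+1}\mid X_n=x)=\tau_\varepsilon(x,\cdot)$. Then $\mathscr{F}^{\tau_\varepsilon}$ is the filtration $\mathscr{F}^{\tau_\varepsilon}_n=\Sigma(X_m:m\le n)$, $n\le 0$. *)

(* Defs.v *)
From HB Require Import structures.
From mathcomp Require Import all_boot all_order all_algebra finmap.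
From mathcomp Require Import all_classical all_reals all_analysis.

Set Implicit Arguments.
Unset Strict Implicit.
Unset Printing Implicit Defensive.

Import Order.TTheory GRing.Theory Num.Theory.
Import numFieldNormedType.Exports.

Local Open Scope classical_set_scope.
Local Open Scope ring_scope.

HB.mixin Record isSeparable T & Topological T := {
  separable : exists2 D : set T, countable D & dense D
}.

#[short(type="polishMetricType")]
HB.structure Definition PolishMetric (R : realType) :=
  {T of Metric R T & Complete T & Pointed T & isSeparable T}.

Notation borel E := (g_sigma_algebraType (@open E)).

Definition cylinders (I : Type) (d : I -> measure_display)
    (E : forall i, measurableType (d i)) : set (set (forall i, E i)) :=
  \bigcup_i preimage_set_system setT (fun x => x i) measurable.
Arguments cylinders {I d} E.

Notation trajectories E := (g_sigma_algebraType (cylinders E)).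

Section ProbabilitySpaces.
Context (R : realType).

(* The sigma-algebra of Omega is the P-completion of the Borel sigma-algebra of
   a Polish topology (transported along the bijection f).  Completing at once
   makes the complete sigma-algebras [Sigma P X J] below consist of events. *)
Definition polish_probability d (Omega : measurableType d)
    (P : probability Omega R) : Prop :=
  exists (S : polishMetricType R) (f : Omega -> S), bijective f /\
    forall A : set Omega, measurable A <->
      exists B1 B2 : set (borel S),
        [/\ measurable B1, measurable B2, f @^-1` B1 `<=` A,
            A `<=` f @^-1` B2 & P (f @^-1` (B2 `\` B1)) = 0%E].

Definition measurable_wrt (Omega : Type) d (E : measurableType d)
    (H : set (set Omega)) (Y : Omega -> E) : Prop :=
  forall B : set E, measurable B -> H (Y @^-1` B).

Section OneSpace.
Context d (Omega : measurableType d) (P : probability Omega R).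

Definition Sigma (I : Type) (dE : I -> measure_display)
    (E : forall i, measurableType (dE i)) (X : forall i, Omega -> E i)
    (J : set I) : set (set Omega) :=
  <<s [set N | P.-negligible N] `|`
      \bigcup_(i in J) preimage_set_system setT (X i) measurable >>.

Definition mutually_independent (I : choiceType) (dE : I -> measure_display)
    (E : forall i, measurableType (dE i)) (X : forall i, Omega -> E i) : Prop :=
  forall (J : {fset I}) (B : forall i, set (E i)),
    (forall i, measurable (B i)) ->
    P (\bigcap_(i in [set` J]) X i @^-1` B i) =
      (\prod_(i <- J) P (X i @^-1` B i))%E.

Definition independent (F G : set (set Omega)) : Prop :=
  forall A B, F A -> G B -> P (A `&` B) = (P A * P B)%E.

(* f is a version of the conditional probability P(A | H). *)
Definition cond_prob (H : set (set Omega)) (A : set Omega) (f : Omega -> R) :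
    Prop :=
  [/\ measurable_wrt H f, P.-integrable setT (EFin \o f) &
      forall C, H C -> (\int[P]_(w in C) (f w)%:E)%E = P (A `&` C)].

Definition cond_independent (H F G : set (set Omega)) : Prop :=
  forall A B, F A -> G B ->
    exists f g : Omega -> R,
      [/\ cond_prob H A f, cond_prob H B g &
          cond_prob H (A `&` B) (fun w => f w * g w)].

End OneSpace.

(* Filtrations are indexed by k : nat standing for the instant n = - k <= 0, so
   F k.+1 is the past of F k, and "m <= n" becomes "k <= m". *)
Definition filtration (Omega : Type) := nat -> set (set Omega).

Definition joinF (Omega : Type) (F G : filtration Omega) : filtration Omega :=
  fun k => <<s F k `|` G k >>.

Section Filtrations.
Context d (Omega : measurableType d) (P : probability Omega R).

Definition generated_by (F : filtration Omega) (E : nat -> polishMetricType R)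
    (X : forall k, Omega -> borel (E k)) : Prop :=
  (forall k, measurable_fun setT (X k)) /\
  (forall k, F k = Sigma P X [set m | (k <= m)%N]).

Definition immersed (F G : filtration Omega) : Prop :=
  (forall k, F k `<=` G k) /\
  (forall k, cond_independent P (F k.+1) (F k) (G k.+1)).

Definition jointly_immersed (F G : filtration Omega) : Prop :=
  immersed F (joinF F G) /\ immersed G (joinF F G).

Definition product_type (F : filtration Omega) : Prop :=
  exists (E : nat -> polishMetricType R) (X : forall k, Omega -> borel (E k)),
    generated_by F X /\ mutually_independent P X.

End Filtrations.

Definition trajectory (Omega I : Type) (E : I -> Type)
    (X : forall i, Omega -> E i) : Omega -> forall i, E i :=
  fun w i => X i w.

Section TwoSpaces.
Context d (Omega : measurableType d) (P : probability Omega R).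
Context d' (Omega' : measurableType d') (P' : probability Omega' R).

Definition same_law (E : nat -> polishMetricType R)
    (X : forall k, Omega -> borel (E k))
    (X' : forall k, Omega' -> borel (E k)) : Prop :=
  forall B : set (trajectories (fun k => borel (E k))), measurable B ->
    P (trajectory X @^-1` B) = P' (trajectory X' @^-1` B).

Definition isomorphic_via (F : filtration Omega) (F' : filtration Omega')
    (E : nat -> polishMetricType R) (X : forall k, Omega -> borel (E k))
    (X' : forall k, Omega' -> borel (E k)) : Prop :=
  [/\ generated_by P F X, generated_by P' F' X' & same_law X X'].

Definition isomorphic (F : filtration Omega) (F' : filtration Omega') : Prop :=
  exists (E : nat -> polishMetricType R) (X : forall k, Omega -> borel (E k))
    (X' : forall k, Omega' -> borel (E k)), isomorphic_via F F' X X'.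

Definition copy (F : filtration Omega) (F' : filtration Omega')
    (S : polishMetricType R) (Y : Omega -> S) (Y' : Omega' -> S) : Prop :=
  exists (E : nat -> polishMetricType R) (X : forall k, Omega -> borel (E k))
    (X' : forall k, Omega' -> borel (E k))
    (phi : trajectories (fun k => borel (E k)) -> borel S),
    [/\ isomorphic_via F F' X X', measurable_fun setT phi,
        {ae P, forall w, Y w = phi (trajectory X w)} &
        forall w, Y' w = phi (trajectory X' w)].

Definition immersible (F : filtration Omega) (G : filtration Omega') : Prop :=
  exists F' : filtration Omega', isomorphic F F' /\ immersed P' F' G.

Definition real_time_coupling (F : filtration Omega)
    (F' F'' : filtration Omega') : Prop :=
  [/\ isomorphic F F', isomorphic F F'' & jointly_immersed P' F' F''].

Definition independent_in_distant_past (F' F'' : filtration Omega') : Prop :=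
  exists k, independent P' (F' k) (F'' k).

End TwoSpaces.

Section Classification.
Context d (Omega : measurableType d) (P : probability Omega R).

Definition standard (F : filtration Omega) : Prop :=
  exists d' (Omega' : measurableType d') (P' : probability Omega' R)
    (G : filtration Omega'),
    [/\ polish_probability P', product_type P' G & immersible P P' F G].

Definition I_cosy_rv (F : filtration Omega) (S : polishMetricType R)
    (Y : Omega -> S) : Prop :=
  forall delta : R, 0 < delta ->
  exists d' (Omega' : measurableType d') (P' : probability Omega' R)
    (F' F'' : filtration Omega') (Y' Y'' : Omega' -> S),
    [/\ polish_probability P', real_time_coupling P P' F F' F'' &
        independent_in_distant_past P' F' F''] /\
    [/\ copy P P' F F' Y Y', copy P P' F F'' Y Y'' &
        ((1 - delta)%:E < P' [set w | (mdist (Y' w) (Y'' w) < delta)%R])%E].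

Definition I_cosy (F : filtration Omega) : Prop :=
  forall (S : polishMetricType R) (Y : Omega -> S),
    measurable_wrt (F 0%N) (Y : Omega -> borel S) -> I_cosy_rv F Y.

End Classification.
End ProbabilitySpaces.

Definition alphabet (A : finZmodType) : Type := A.

Section Alphabet.
Variable A : finZmodType.
HB.instance Definition _ := FinRing.Zmodule.on (alphabet A).
HB.instance Definition _ := isPointed.Build (alphabet A) 0.
HB.instance Definition _ := @isMeasurable.Build default_measure_display
  (alphabet A) discrete_measurable discrete_measurable0
  discrete_measurableC discrete_measurableU.
End Alphabet.

Notation config A := (trajectories (fun _ : int => alphabet A)).

Section CellularAutomaton.
Context (R : realType) (A : finZmodType).

Definition tau (x : config A) : config A := fun i => x i + x (i + 1).

Definition iid_coordinates (p : A -> R) (nu : probability (config A) R) :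
    Prop :=
  mutually_independent nu (fun (i : int) (x : config A) => x i) /\
  forall (i : int) (a : alphabet A), nu [set x | x i = a] = (p a)%:E.

Definition noise_weight (eps : R) (a : A) : R :=
  if a == 0 then 1 - eps else eps / (#|A|%:R - 1).

Definition uniform_weight (a : A) : R := #|A|%:R^-1.

(* tau_eps(x, .), where nu is the law of the noise xi. *)
Definition tau_kernel (nu : probability (config A) R) (x : config A) :
    set (config A) -> \bar R :=
  pushforward nu (fun xi : config A => (fun i => tau x i + xi i) : config A).

(* Stationary Markov chain with one-time marginal mu and transition kernel
   tau_eps; the Markov property is stated with respect to the whole past. *)
Definition stationary_chain (nu mu : probability (config A) R)
    d (Omega : measurableType d) (P : probability Omega R)
    (X : int -> Omega -> config A) : Prop :=
  [/\ forall n, measurable_fun setT (X n),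
      forall n (B : set (config A)), measurable B -> P (X n @^-1` B) = mu B &
      forall n (B : set (config A)), measurable B ->
        cond_prob P (Sigma P X [set m | m <= n]) (X (n + 1) @^-1` B)
          (fun w => fine (tau_kernel nu (X n w) B))].

Definition negative_time_filtration d (Omega : measurableType d)
    (P : probability Omega R) (X : int -> Omega -> config A) :
    filtration Omega :=
  fun k => Sigma P X [set m | m <= - k%:Z].

End CellularAutomaton.

(* Main.v *)
Require Import Defs.
From HB Require Import structures.
From mathcomp Require Import all_boot all_order all_algebra finmap.
From mathcomp Require Import zify lra.
From mathcomp Require Import all_classical all_reals all_analysis.
From mathcomp Require Import measurable_realfun.

(** The chain is rebuilt from independent innovations, each configuration being
    a function of the previous one and of an innovation, in such a way that the
    distant past is forgotten.

    At time -k the innovation V k is a configuration with the law nu of the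
    noise, whose letters are read as a family v^a(j) indexed by a letter a and a
    site j.  The noise actually used at j is v^a(j), where a may depend on the
    current configuration and on the noise already used at the sites to the
    right of j.  Whatever the rule that selects a, distinct sites read distinct
    letters, and the noise has the law nu given the past (lemma [noise_law]), so
    the chain has the transition kernel of the automaton.

    The rule is chosen as follows.  As tau is additive and looks to the right
    only, the value at j that tau^m would produce from the configuration under
    construction is known up to the noise at j, which enters it with coefficient
    one ([iter_tau_diag]).  In a window of sites, a is taken to be this predicted
    value without its last term.  With positive probability v^a(j) = -a for all
    letters a and all j in the window; then all predicted values are set to 0,
    whatever the configuration was, and m steps later any two chains that read
    the same innovations agree on the window ([run_coalesce]).

    Time is divided into blocks, each aiming at its own end.  Going back in time,
    their windows are wide enough for the agreement to survive all later blocks,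
    and the blocks are long enough for the probability of failure to tend to 0.
    Hence the chains started ever earlier from the null configuration converge
    almost surely, letter by letter, to a chain that is a function of the
    innovations ([past_limit_step_ae]).  Its marginals are the invariant law mu:
    a chain started from mu keeps this law ([run_law]) and agrees with the limit
    near the origin outside an event of small probability ([chain_law]).  One
    marginal and the kernel determine the law of the trajectory
    ([markov_same_law]), so the limit is a copy of the given chain.

    Since an innovation is independent of the whole past, the filtration of the
    limit is immersed in that of the innovations ([chain_immersed]), which is of
    product type.  This is standardness.

    For cosiness, two such chains are fed with the same innovations during the
    last N steps and with independent ones before.  The coupling is real-time,
    again by immersion, and independent in the distant past.  As N grows, every
    event on the first trajectory coincides with the same event on the second
    one up to a vanishing probability: these events form a sigma-algebra
    ([detected_sigma_algebra]) that contains those on single letters, by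
    coalescence ([chains_detected]).  Finally, a variable of the filtration with
    values in a Polish space is almost surely a measurable function of the
    trajectory ([doob_dynkin]), and events on finitely many small balls bring its
    two copies close to each other ([detected_close]). *)

Set Implicit Arguments.
Unset Strict Implicit.
Unset Printing Implicit Defensive.

Import Order.TTheory GRing.Theory Num.Theory.
Import numFieldNormedType.Exports.

Local Open Scope classical_set_scope.
Local Open Scope ring_scope.

(** * Configurations as a Polish space *)

Section Cylinders.
Variable A : Type.
Implicit Types (x y z : int -> A) (n : nat).

Definition cyl n x : set (int -> A) :=
  [set y | forall i : int, (`|i|%N <= n)%N -> y i = x i].

Lemma cyl_sym n x y : cyl n x y -> cyl n y x.
Proof. by move=> xy i /xy. Qed.

Lemma cyl_eq n x y : cyl n x y -> cyl n y = cyl n x.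
Proof.
by move=> xy; apply/seteqP; split=> z zy i ilt; rewrite zy // xy.
Qed.

Lemma cyl_mono m n x : (m <= n)%N -> cyl n x `<=` cyl m x.
Proof. by move=> mn y xy i im; apply: xy; apply: leq_trans mn. Qed.

Lemma cyl_all x y : (forall n, cyl n x y) -> x = y.
Proof. by move=> xy; apply/funext => i; rewrite (xy `|i|%N). Qed.

End Cylinders.

Section ConfigMetric.
Variables (R : realType) (A : finZmodType).

Definition polish_config : Type := int -> A.
Implicit Types (x y z : polish_config) (n : nat).

(* The distance of distinct x and y is 2^-n, where n is the least radius at
   which they disagree. *)
Let apart x y : pred nat := fun n => `[< ~ cyl n x y >].

Definition config_dist x y : R :=
  if pselect (exists n, apart x y n) is left xy
  then (2 ^+ ex_minn xy)^-1 else 0.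

Lemma config_dist_lt x y n : (config_dist x y < (2 ^+ n)^-1) <-> cyl n x y.
Proof.
rewrite /config_dist; case: pselect => [xy|nxy]; last first.
  split=> [_|_]; last by rewrite invr_gt0 exprn_gt0.
  by apply: contrapT => h; apply: nxy; exists n; apply/asboolP.
case: ex_minnP => m /asboolP am min_m.
rewrite ltf_pV2 ?posrE ?exprn_gt0// ltr_eXn2l ?ltr1n//.
split=> [nm|nxy].
  apply: contrapT => h; have := min_m n; rewrite leqNgt nm => H.
  by have /H : apart x y n by apply/asboolP.
by rewrite ltnNge; apply/negP => mn; apply: am; exact: cyl_mono nxy.
Qed.

Lemma config_dist_cases x y :
  config_dist x y = 0 \/ exists n, config_dist x y = (2 ^+ n)^-1.
Proof.
rewrite /config_dist; case: pselect => [xy|nxy]; last by left.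
by right; eexists.
Qed.

Lemma config_dist_ge0 x y : 0 <= config_dist x y.
Proof.
have [->//|[n ->]] := config_dist_cases x y.
by rewrite invr_ge0 exprn_ge0.
Qed.

Lemma config_distxx x : config_dist x x = 0.
Proof.
have [//|[n xx]] := config_dist_cases x x.
by have /config_dist_lt : cyl n x x by []; rewrite xx ltxx.
Qed.

Lemma config_dist_eq0 x y : config_dist x y = 0 -> x = y.
Proof.
by move=> xy; apply: cyl_all => n; apply/config_dist_lt; rewrite xy invr_gt0 exprn_gt0.
Qed.

Lemma config_dist_sym x y : config_dist x y = config_dist y x.
Proof.
have H a b : config_dist a b <= config_dist b a.
  have [->|[n ab]] := config_dist_cases a b; first exact: config_dist_ge0.
  rewrite ab leNgt; apply/negP => /config_dist_lt /cyl_sym /config_dist_lt.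
  by rewrite ab ltxx.
by apply/eqP; rewrite eq_le !H.
Qed.

(** Agreement on [[-n, n]] is transitive, whence even an ultrametric inequality. *)
Lemma config_dist_triangle y x z :
  config_dist x z <= config_dist x y + config_dist y z.
Proof.
have [->|[n xz]] := config_dist_cases x z.
  by rewrite addr_ge0 // config_dist_ge0.
have [xy|xy] := ltP (config_dist x y) (2 ^+ n)^-1; last first.
  by rewrite xz (le_trans xy) // lerDl config_dist_ge0.
have [yz|yz] := ltP (config_dist y z) (2 ^+ n)^-1; last first.
  by rewrite xz (le_trans yz) // lerDr config_dist_ge0.
have /config_dist_lt : cyl n x z.
  by rewrite -(cyl_eq (proj1 (config_dist_lt _ _ _) xy)); apply/config_dist_lt.
by rewrite xz ltxx.
Qed.

HB.instance Definition _ := gen_eqMixin polish_config.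
HB.instance Definition _ := gen_choiceMixin polish_config.
HB.instance Definition _ := isPointed.Build polish_config (fun=> 0).
HB.instance Definition _ := @isMetric.Build R polish_config config_dist
  config_distxx config_dist_eq0 config_dist_sym config_dist_triangle.

Lemma ball_cyl x n : ball x (2 ^+ n)^-1 = cyl n x.
Proof.
rewrite ballEmdist; apply/seteqP; split=> y /=; by move/config_dist_lt.
Qed.

Lemma exists_half_lt (e : R) : 0 < e -> exists n, (2 ^+ n)^-1 < e.
Proof.
move=> e0; have := cvg_geometric 1 (_ : `|2^-1 : R| < 1).
have h : `|2^-1 : R| < 1 by rewrite ger0_norm ?invr_ge0// invf_lt1 ?ltr1n.
move/(_ h)/cvgrPdist_lt/(_ _ e0) => [N _ /(_ N)/=]; rewrite leqnn => /(_ isT).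
rewrite sub0r normrN /geometric /= mul1r ger0_norm ?exprn_ge0 ?invr_ge0//.
by rewrite exprVn => ?; exists N.
Qed.

Lemma nbhs_cyl x (U : set polish_config) :
  nbhs x U <-> exists n, cyl n x `<=` U.
Proof.
split=> [/nbhs_ballP[e /= e0 xU]|[n xU]]; last first.
  by apply/nbhs_ballP; exists (2 ^+ n)^-1; rewrite ?ball_cyl //= invr_gt0 exprn_gt0.
have [n ne] := exists_half_lt e0; exists n; rewrite -ball_cyl.
exact: subset_trans (le_ball (ltW ne)) xU.
Qed.

Let config_complete (F : set_system polish_config) :
  ProperFilter F -> cauchy F -> cvg F.
Proof.
move=> FF /cauchyP Fc.
have /choice[c cF] n : exists x, F (cyl n x).
  have [|x] := Fc (2 ^+ n)^-1; first by rewrite invr_gt0 exprn_gt0.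
  by rewrite ball_cyl => Fx; exists x.
(* c n approximates the limit on [[-n, n]]; the diagonal choice of n makes the
   limit a total configuration. *)
pose l : polish_config := fun i => c `|i|%N i.
apply/cvg_ex; exists l => U /nbhs_cyl[n lU].
apply: filterS (cF n); apply: subset_trans lU.
suff -> : cyl n l = cyl n (c n) by [].
apply: cyl_eq => i ilt; rewrite /l.
have [y [yi yn]] := @filter_ex _ _ FF _ (filterI (cF `|i|%N) (cF n)).
by rewrite -yi // yn.
Qed.

HB.instance Definition _ :=
  Uniform_isComplete.Build polish_config config_complete.

(** Finitely supported configurations, listed along a numbering of the sites,
    form a countable dense set. *)
Definition finite_config (s : seq A) : polish_config :=
  fun i => nth 0 s (choice.pickle i).

Lemma finite_config_dense x n : exists s, cyl n x (finite_config s).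
Proof.
pose N := (\max_(i < n.+1) maxn (choice.pickle (Posz i)) (choice.pickle (- Posz i)%R)).+1.
exists (mkseq (fun k => oapp x 0 (choice.unpickle k)) N) => i ilt.
rewrite /finite_config nth_mkseq ?choice.pickleK // ltnS.
have H : (choice.pickle i <= maxn (choice.pickle (Posz `|i|%N)) (choice.pickle (- Posz `|i|%N)%R))%N.
  rewrite leq_max; case: (lerP 0 i) => i0.
    by rewrite gez0_abs // leqnn.
  by rewrite ltz0_abs // opprK leqnn orbT.
by apply: leq_trans H _; apply: (@leq_bigmax _ _ (Ordinal (_ : `|i|%N < n.+1)%N)).
Qed.

Let config_separable : exists2 D : set polish_config, countable D & dense D.
Proof.
exists (range finite_config).
  exact: card_le_trans (card_image_le _ _) (countableP _).
move=> O [x Ox] Oop.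
have /nbhs_cyl[n xO] : nbhs x O by apply: open_nbhs_nbhs.
have [s xs] := finite_config_dense x n.
by exists (finite_config s); split; [exact: xO|exists s].
Qed.

HB.instance Definition _ := isSeparable.Build polish_config config_separable.

End ConfigMetric.

Definition pconfig (R : realType) (A : finZmodType) : polishMetricType R :=
  polish_config A.

(** * Measurable sets of configurations *)

Section ConfigMeasurable.
Variables (R : realType) (A : finZmodType).

Lemma measurable_site (i : int) (B : set (alphabet A)) :
  measurable [set x : config A | B (x i)].
Proof. by apply: sub_sigma_algebra; exists i => //; exists B => //; rewrite setTI. Qed.

Lemma measurable_fun_site (i : int) : measurable_fun setT (fun x : config A => x i).
Proof. by move=> _ B _; rewrite setTI; exact: measurable_site. Qed.

(** Only finitely many letters exist, so a letter computed from measurable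
    letters is measurable, whatever the rule. *)
Lemma measurable_fun_letter d (T : measurableType d) (f : T -> alphabet A) :
  (forall a, measurable (f @^-1` [set a])) -> measurable_fun setT f.
Proof.
move=> fm _ B _; rewrite setTI.
rewrite [X in measurable X](_ : _ = \bigcup_(a in B) (f @^-1` [set a])).
  apply: fin_bigcup_measurable => //.
  by apply: (sub_finite_set (@subsetT _ B)); exact: finite_finset.
apply/seteqP; split=> [t Bt|t [a Ba fa]]; first by exists (f t).
by rewrite /preimage /= fa.
Qed.

Lemma measurable_fun_letter2 d (T : measurableType d)
    (op : alphabet A -> alphabet A -> alphabet A) (f g : T -> alphabet A) :
  measurable_fun setT f -> measurable_fun setT g ->
  measurable_fun setT (fun t => op (f t) (g t)).
Proof.
move=> mf mg; apply: measurable_fun_letter => a.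
rewrite [X in measurable X](_ : _ =
    \bigcup_b (f @^-1` [set b] `&` (g @^-1` [set c | op b c = a]))).
  apply: fin_bigcup_measurable => [|b _]; first exact: finite_finset.
  apply: measurableI; first by rewrite -[X in measurable X]setTI; exact: mf.
  by rewrite -[X in measurable X]setTI; exact: mg.
apply/seteqP; split=> [t ta|t [b _ [fb gb]]]; first by exists (f t).
by move: gb; rewrite /preimage /= fb.
Qed.

Lemma measurable_fun_config d (T : measurableType d) (f : T -> config A) :
  (forall i, measurable_fun setT (fun t => f t i)) -> measurable_fun setT f.
Proof.
move=> fi; apply: (@measurability _ _ _ _ _ f (cylinders (fun _ : int => alphabet A))) => //.
move=> _ [_ [i _ [B mB <-]] <-]; rewrite setTI.
by have := fi i measurableT B mB; rewrite !setTI.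
Qed.

Lemma measurable_cyl n (x : config A) : measurable (cyl n x : set (config A)).
Proof.
have -> : cyl n x = \bigcap_i [set y : config A | (`|i|%N <= n)%N -> y i = x i].
  by apply/seteqP; split=> y /=; [move=> h i _; exact: h|move=> h i; exact: h].
rewrite -[X in measurable X]setCK setC_bigcap; apply: measurableC.
apply: countable_bigcupT_measurable => // i; apply: measurableC.
exact: (measurable_site i (fun a => (`|i|%N <= n)%N -> a = x i)).
Qed.

Lemma open_config_measurable (O : set (pconfig R A)) :
  open O -> measurable (O : set (config A)).
Proof.
move=> Oop.
have -> : O = \bigcup_(ns : nat * seq A)
    [set x | cyl ns.1 (finite_config ns.2) x /\
             cyl ns.1 (finite_config ns.2) `<=` O].
  apply/seteqP; split=> [x Ox|x [ns _ []]]; last by move=> + H; exact: H.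
  have /nbhs_cyl[n xO] : nbhs (x : pconfig R A) O by apply: open_nbhs_nbhs.
  have [s xs] := finite_config_dense x n.
  exists (n, s) => //=; split; first exact: cyl_sym.
  by rewrite (cyl_eq xs).
apply: countable_bigcupT_measurable => // -[n s] /=.
have [H|H] := pselect (cyl n (finite_config s) `<=` O).
  rewrite [X in measurable X](_ : _ = cyl n (finite_config s)).
    exact: measurable_cyl.
  by apply/seteqP; split=> [x []//|x xs]; split.
rewrite [X in measurable X](_ : _ = set0) //.
by apply/seteqP; split=> [x []//|//].
Qed.

(** An open set is a countable union of cylinders, and conversely fixing one
    letter is an open condition. *)
Lemma borel_configE :
  @measurable _ (borel (pconfig R A)) = @measurable _ (config A).
Proof.
apply/seteqP; split.
  apply: smallest_sub => [|O]; first exact: sigma_algebra_measurable.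
  exact: open_config_measurable.
apply: smallest_sub => [|_ [i _ [B mB <-]]].
  exact: sigma_algebra_measurable.
apply: sub_sigma_algebra; rewrite setTI openE => x /= Bx.
by apply/nbhs_cyl; exists `|i|%N => y /(_ i (leqnn _)) yx; rewrite /preimage /= yx.
Qed.

(** Intervals of sites generate: a probability on configurations is determined
    by its values on the sets fixing all the letters of [[-n, n]]. *)
Definition cyl_sets (n0 : nat) : set (set (config A)) :=
  [set B | [\/ B = set0, B = setT | exists n x, (n0 <= n)%N /\ B = cyl n x]].

Lemma cyl_sets_setI n0 : setI_closed (cyl_sets n0).
Proof.
move=> B C [->|->|[n [x [n0n ->]]]]; [by rewrite set0I; constructor 1|by rewrite setTI|].
move=> [->|->|[m [y [n0m ->]]]]; [by rewrite setI0; constructor 1| |].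
  by rewrite setIT; constructor 3; exists n, x.
wlog nm : n m x y n0n n0m / (n <= m)%N.
  move=> H; case/orP: (leq_total n m) => nm; first exact: H.
  by rewrite setIC; exact: H.
have [xy|nxy] := pselect (cyl n x y); last first.
  constructor 1; apply/seteqP; split=> // z [zx /(cyl_mono nm) zy]; apply: nxy => i ilt.
  by rewrite -zy // zx.
rewrite setIidr; first by apply: Or33; exists m, y.
by rewrite -(cyl_eq xy); exact: cyl_mono.
Qed.

Lemma cyl_sets_measurable n0 : cyl_sets n0 `<=` measurable.
Proof. by move=> B [->|->|[n [x [_ ->]]]] //; exact: measurable_cyl. Qed.

Lemma cyl_sets_generate n0 : @measurable _ (config A) = <<s cyl_sets n0 >>.
Proof.
apply/seteqP; split; last first.
  by apply: smallest_sub; [exact: sigma_algebra_measurable|exact: cyl_sets_measurable].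
apply: smallest_sub => [|_ [i _ [B mB <-]]]; first exact: smallest_sigma_algebra.
pose T := g_sigma_algebraType (cyl_sets n0); pose n := maxn n0 `|i|%N.
rewrite setTI [X in _ X](_ : _ = \bigcup_(s : seq A)
    [set x | cyl n (finite_config s) x /\ B (finite_config s i)]).
  apply: (@countable_bigcupT_measurable _ T) => // s.
  have [Bs|Bs] := pselect (B (finite_config s i)); last first.
    rewrite [X in measurable X](_ : _ = set0) //.
    by apply/seteqP; split=> [x []//|//].
  rewrite [X in measurable X](_ : _ = cyl n (finite_config s)).
    apply: sub_sigma_algebra; apply: Or33; exists n, (finite_config s).
    by rewrite leq_maxl.
  by apply/seteqP; split=> [x []//|x xs]; split.
apply/seteqP; split=> [x Bx|x [s _ [/(_ i) + Bs]]]; last first.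
  by rewrite leq_maxr => /(_ isT); rewrite /preimage /= => ->.
have [s xs] := finite_config_dense x n; exists s => //.
by split; [exact: cyl_sym|rewrite (xs i) // leq_maxr].
Qed.

Lemma config_probability_eq n0 (m1 m2 : probability (config A) R) :
  (forall n x, (n0 <= n)%N -> m1 (cyl n x) = m2 (cyl n x)) ->
  forall B, measurable B -> m1 B = m2 B.
Proof.
move=> m12.
have m1T : m1 setT = 1%E := probability_setT m1.
have m2T : m2 setT = 1%E := probability_setT m2.
apply: (measure_unique (cyl_sets n0) (fun=> setT)) => //.
- exact: cyl_sets_generate.
- exact: cyl_sets_setI.
- by move=> _; constructor 2.
- by rewrite bigcup_const //; exists 0%N.
- move=> B [->|->|[n [x [n0n ->]]]]; [by rewrite !measure0| |exact: m12].
  by rewrite [LHS]m1T [RHS]m2T.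
- by move=> _; rewrite [X in (X < _)%E]m1T ltry.
Qed.

End ConfigMeasurable.

(** * Null sets and completions *)

Lemma pi_measure_eq d (T : measurableType d) (R : realType) (G : set (set T))
    (m1 m2 : {measure set T -> \bar R}) :
  G `<=` measurable -> setI_closed G -> (m1 setT < +oo)%E ->
  m1 setT = m2 setT -> (forall A, G A -> m1 A = m2 A) ->
  forall A, <<s G >> A -> m1 A = m2 A.
Proof.
move=> Gm GI m1oo m12T m12 A GA.
pose G' : set (set T) := G `|` [set setT].
apply: (@g_sigma_algebra_measure_unique _ _ _ G' _ (fun=> setT)) => //.
- by move=> B [/Gm//|->].
- by move=> _; right.
- by rewrite bigcup_const //; exists 0%N.
- move=> B C [GB|->] [GC|->]; rewrite ?setTI ?setIT; [|by left..|by right].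
  by left; exact: GI.
- by move=> B [/m12//|->].
- by apply: sub_sigma_algebra2 GA; left.
Qed.

(** The underlying type is kept, so that a configuration is an outcome of the
    completed space; the measure m only selects the sigma-algebra. *)
Definition completed (R : realType) d (T : measurableType d)
  (m : probability T R) : Type := T.

Section Completion.
Context (R : realType) d (T : measurableType d) (m : probability T R).

Definition sandwiched (A B1 B2 : set T) : Prop :=
  [/\ measurable B1, measurable B2, B1 `<=` A, A `<=` B2 & m (B2 `\` B1) = 0%E].

Local Notation completed := (completed m).

Definition completed_measurable : set (set completed) :=
  [set A | exists B1 B2, sandwiched A B1 B2].

HB.instance Definition _ := Pointed.on completed.

Let completed0 : completed_measurable set0.
Proof. by exists set0, set0; split => //; rewrite setD0 measure0. Qed.

Let completedC (A : set completed) :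
  completed_measurable A -> completed_measurable (~` A).
Proof.
move=> [B1 [B2 [m1 m2 s1 s2 e]]]; exists (~` B2), (~` B1).
split; [exact: measurableC|exact: measurableC|exact: subsetC|exact: subsetC|].
by rewrite -e; congr (m _); rewrite !setDE setCK setIC.
Qed.

Let completedU (F : (set completed)^nat) :
  (forall i, completed_measurable (F i)) -> completed_measurable (\bigcup_i F i).
Proof.
move=> /choice[B1 /choice[B2 FB]]; exists (\bigcup_i B1 i), (\bigcup_i B2 i).
have mB1 i : measurable (B1 i) by have [] := FB i.
have mB2 i : measurable (B2 i) by have [] := FB i.
split; [exact: bigcupT_measurable|exact: bigcupT_measurable| | |].
- by apply: subset_bigcup => i _; have [] := FB i.
- by apply: subset_bigcup => i _; have [] := FB i.
apply: (@subset_measure0 _ _ _ _ _ (\bigcup_i (B2 i `\` B1 i))).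
- by apply: measurableD; exact: bigcupT_measurable.
- by apply: bigcupT_measurable => i; exact: measurableD.
- by move=> x [[i _ B2x] nB1]; exists i => //; split=> // B1x; apply: nB1; exists i.
apply/eqP; rewrite -measure_le0.
apply: le_trans (generalized_Boole_inequality _ _ _) _ => //.
- by move=> i; exact: measurableD.
- by apply: bigcupT_measurable => i; exact: measurableD.
- by rewrite eseries0 // => i _ _; have [] := FB i.
Qed.

HB.instance Definition _ := @isMeasurable.Build default_measure_display
  completed completed_measurable completed0 completedC completedU.

Lemma sandwiched_outer A B1 B2 : sandwiched A B1 B2 -> m B2 = m B1.
Proof.
move=> [m1 m2 s1 s2 e]; rewrite -(setDUK (subset_trans s1 s2)) measureU //.
- by rewrite [X in (_ + X)%E]e adde0.
- exact: measurableD.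
- by rewrite setDE setICA setICr setI0.
Qed.

(** Each inner set is contained in the other outer set, which has the measure of
    its own inner set. *)
Lemma sandwiched_measure_eq A B1 B2 C1 C2 :
  sandwiched A B1 B2 -> sandwiched A C1 C2 -> m B1 = m C1.
Proof.
have H D1 D2 E1 E2 : sandwiched A D1 D2 -> sandwiched A E1 E2 -> (m D1 <= m E1)%E.
  move=> [mD1 mD2 D1A AD2 D0] [mE1 mE2 E1A AE2 E0].
  have <- : m E2 = m E1 by apply: (@sandwiched_outer A).
  by apply: le_measure; rewrite ?inE //; exact: subset_trans D1A AE2.
by move=> AB AC12; apply/eqP; rewrite eq_le !(H _ _ _ _ AB AC12, H _ _ _ _ AC12 AB).
Qed.

(** A null sandwich has inner sets of one measure only, so any choice of the
    inner set will do. *)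
Definition completion (A : set completed) : \bar R :=
  if pselect (completed_measurable A) is left mA then m (sval (cid mA)) else 0.

Lemma completionE A B1 B2 : sandwiched A B1 B2 -> completion A = m B1.
Proof.
move=> AB; rewrite /completion; case: pselect => [mA|]; last by case; exists B1, B2.
by case: cid => C1 [C2 AC12] /=; exact: sandwiched_measure_eq AC12 AB.
Qed.

Lemma measurable_sandwiched (A : set T) : measurable A -> sandwiched A A A.
Proof. by move=> mA; split => //; rewrite setDv measure0. Qed.

Lemma completion_measurable (A : set T) : measurable A -> completion A = m A.
Proof. by move=> mA; exact/completionE/measurable_sandwiched. Qed.

Lemma measurable_completed (A : set T) :
  measurable A -> measurable (A : set completed).
Proof. by move=> mA; exists A, A; exact: measurable_sandwiched. Qed.

Let completion0 : completion set0 = 0%E.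
Proof. by rewrite completion_measurable // measure0. Qed.

Let completion_ge0 A : (0 <= completion A)%E.
Proof. by rewrite /completion; case: pselect. Qed.

Let completion_additive : semi_sigma_additive completion.
Proof.
move=> F mF tF mUF; have /choice[B1 /choice[B2 FB]] := mF.
have mB1 i : measurable (B1 i) by have [] := FB i.
have mB2 i : measurable (B2 i) by have [] := FB i.
have B1F i : B1 i `<=` F i by have [] := FB i.
have FB2 i : F i `<=` B2 i by have [] := FB i.
have B0 i : m (B2 i `\` B1 i) = 0%E by have [] := FB i.
have -> : completion (\bigcup_i F i) = m (\bigcup_i B1 i).
  apply: (@completionE _ _ (\bigcup_i B2 i)); split.
  - exact: bigcupT_measurable.
  - exact: bigcupT_measurable.
  - by apply: subset_bigcup => i _.
  - by apply: subset_bigcup => i _.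
  apply: (@subset_measure0 _ _ _ _ _ (\bigcup_i (B2 i `\` B1 i))).
  - by apply: measurableD; exact: bigcupT_measurable.
  - by apply: bigcupT_measurable => i; exact: measurableD.
  - by move=> x [[i _ B2x] nB1]; exists i => //; split=> // B1x; apply: nB1; exists i.
  apply/eqP; rewrite -measure_le0.
  apply: le_trans (generalized_Boole_inequality _ _ _) _ => //.
  - by move=> i; exact: measurableD.
  - by apply: bigcupT_measurable => i; exact: measurableD.
  - by rewrite eseries0 // => i _ _; exact: B0.
have -> : (fun n => \sum_(0 <= i < n) completion (F i))%E =
          (fun n => \sum_(0 <= i < n) m (B1 i))%E.
  by apply/funext => n; apply: eq_bigr => i _; exact: completionE (FB i).
apply: measure_semi_sigma_additive => //; last exact: bigcupT_measurable.
apply/trivIsetP => i j _ _ ij; apply/seteqP; split=> // x [/B1F Fi /B1F Fj].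
by move/trivIsetP : tF => /(_ i j Logic.I Logic.I ij) <-; split.
Qed.

HB.instance Definition _ := isMeasure.Build _ _ _ completion
  completion0 completion_ge0 completion_additive.

Let completionT : completion setT = 1%E.
Proof. by rewrite completion_measurable // probability_setT. Qed.

HB.instance Definition _ := Measure_isProbability.Build _ _ _ completion completionT.

Lemma completion_complete : measure_is_complete completion.
Proof.
move=> N [B [[B1 [B2 BB]] + NB]]; rewrite (completionE BB) => B10.
have [mB1 mB2 B1B BB2 B0] := BB; exists set0, B2; split => //.
  exact: subset_trans NB BB2.
by rewrite setD0 (sandwiched_outer BB).
Qed.

Lemma measurable_fun_completed d' (T' : measurableType d') (f : T -> T') :
  measurable_fun setT f -> measurable_fun setT (f : completed -> T').
Proof.
by move=> mf _ B mB; rewrite setTI; apply: measurable_completed; rewrite -[X in measurable X]setTI; exact: mf.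
Qed.

End Completion.

Arguments completion {R d T} m A.

(** * Independence and conditioning on sigma-algebras of events *)

Section SigmaAlgebras.
Context (R : realType) d (Omega : measurableType d) (P : probability Omega R).

Lemma Sigma_sigma_algebra (I : Type) (dE : I -> measure_display)
    (E : forall i, measurableType (dE i)) (X : forall i, Omega -> E i) J :
  sigma_algebra setT (Sigma P X J).
Proof. exact: smallest_sigma_algebra. Qed.

Lemma Sigma_mono (I : Type) (dE : I -> measure_display)
    (E : forall i, measurableType (dE i)) (X : forall i, Omega -> E i) J K :
  J `<=` K -> Sigma P X J `<=` Sigma P X K.
Proof.
move=> JK; apply: sub_sigma_algebra2 => B [?|[i Ji XB]]; first by left.
by right; exists i => //; exact: JK.
Qed.

Lemma Sigma_coordinate (I : Type) (dE : I -> measure_display)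
    (E : forall i, measurableType (dE i)) (X : forall i, Omega -> E i) J i :
  J i -> measurable_wrt (Sigma P X J) (X i).
Proof.
by move=> Ji B mB; apply: sub_sigma_algebra; right; exists i => //; exists B; rewrite ?setTI.
Qed.

Lemma Sigma_measurable (I : Type) (dE : I -> measure_display)
    (E : forall i, measurableType (dE i)) (X : forall i, Omega -> E i) J :
  measure_is_complete P -> (forall i, J i -> measurable_fun setT (X i)) ->
  Sigma P X J `<=` measurable.
Proof.
move=> Pc mX; apply: smallest_sub; first exact: sigma_algebra_measurable.
by move=> B [/Pc//|[i Ji [C mC <-]]]; exact: mX.
Qed.

Lemma Sigma_sub (I I' : Type) (dE : I -> measure_display)
    (dE' : I' -> measure_display)
    (E : forall i, measurableType (dE i)) (X : forall i, Omega -> E i) J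
    (E' : forall i, measurableType (dE' i)) (X' : forall i, Omega -> E' i) J' :
  (forall i, J i -> measurable_wrt (Sigma P X' J') (X i)) ->
  Sigma P X J `<=` Sigma P X' J'.
Proof.
move=> XX'; apply: smallest_sub => [|B [?|[i Ji [C mC <-]]]].
- exact: Sigma_sigma_algebra.
- by apply: sub_sigma_algebra; left.
- by rewrite setTI; exact: XX'.
Qed.

Lemma measurable_wrtP (H : set (set Omega)) d' (E : measurableType d')
    (Y : Omega -> E) :
  sigma_algebra setT H ->
  measurable_wrt H Y <-> measurable_fun setT (Y : g_sigma_algebraType H -> E).
Proof.
move=> sH; split=> [HY _ B mB|mY B mB].
  by rewrite setTI; apply: sub_sigma_algebra; exact: HY.
have := mY measurableT B mB; rewrite setTI.
by rewrite /measurable /= sigma_algebra_id.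
Qed.

Lemma measurable_wrt_fun (H : set (set Omega)) d' (E : measurableType d')
    (Y : Omega -> E) :
  H `<=` measurable -> measurable_wrt H Y -> measurable_fun setT Y.
Proof. by move=> Hm HY _ B mB; rewrite setTI; exact/Hm/HY. Qed.

(** The sets that a null set separates from some event of <<s G>> form a
    sigma-algebra. *)
Lemma negligible_sigma (G : set (set Omega)) (A : set Omega) :
  <<s [set N | P.-negligible N] `|` G >> A ->
  exists2 A', <<s G >> A' & P.-negligible (A `+` A').
Proof.
pose C := [set A | exists2 A', <<s G >> A' & P.-negligible (A `+` A')].
suff : <<s [set N | P.-negligible N] `|` G >> `<=` C by exact.
apply: smallest_sub; last first.
  move=> B [nB|GB]; last first.
    exists B; first exact: sub_sigma_algebra.
    by rewrite setYK; exact: negligible_set0.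
  by exists set0; [exact: sigma_algebra0|rewrite setY0].
split.
- by exists set0; [exact: sigma_algebra0|rewrite setYK; exact: negligible_set0].
- move=> B [B' GB' BB']; exists (setT `\` B'); first exact: sigma_algebraCD.
  apply: negligibleS BB' => w [[[_ nB] B'w]|[[_ nB'] Bw]].
    by right; split=> //; apply: contrapT => nB'; apply: B'w.
  by left; split=> //; apply: contrapT => nB; apply: Bw.
- move=> F FC; have /choice[F' FF'] i :
      exists B, <<s G >> B /\ P.-negligible (F i `+` B).
    by have [B] := FC i; exists B.
  exists (\bigcup_i F' i).
    by apply: sigma_algebra_bigcup => i; have [] := FF' i.
  have := negligible_bigcup (fun i => proj2 (FF' i)).
  apply: negligibleS.
  move=> w [[[i _ Fw] nF']|[[i _ Fw] nF']]; exists i => //.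
    by left; split=> // F'w; apply: nF'; exists i.
  by right; split=> // F'w; apply: nF'; exists i.
Qed.

(** Beyond its null sets, the sigma-algebra of a process is the preimage of the
    product sigma-algebra by the trajectory. *)
Lemma Sigma_trajectory (I : Type) (dE : I -> measure_display)
    (E : forall i, measurableType (dE i)) (X : forall i, Omega -> E i)
    (A : set Omega) :
  Sigma P X setT A -> exists2 S : set (trajectories E), measurable S &
    P.-negligible (A `+` (trajectory X @^-1` S)).
Proof.
move=> /negligible_sigma[A' GA' AA'].
suff : preimage_set_system setT (trajectory X : _ -> trajectories E)
    measurable A' by move=> [S mS SA']; exists S => //; move: AA'; rewrite -SA' setTI.
move: A' GA' {AA'}; apply: smallest_sub.
  by apply: sigma_algebra_preimage; exact: sigma_algebra_measurable.
move=> _ [i _ [B mB <-]]; rewrite setTI.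
exists [set x : trajectories E | B (x i)]; last by rewrite setTI.
by apply: sub_sigma_algebra; exists i => //; exists B => //; rewrite setTI.
Qed.

Lemma measurable_wrt_trajectory (I : Type) (dE : I -> measure_display)
    (E : forall i, measurableType (dE i)) (X : forall i, Omega -> E i)
    (H : set (set Omega)) :
  sigma_algebra setT H -> (forall i, measurable_wrt H (X i)) ->
  measurable_wrt H (trajectory X : Omega -> trajectories E).
Proof.
move=> sH HX; suff : @measurable _ (trajectories E) `<=`
    [set S | H (trajectory X @^-1` S)] by exact.
apply: smallest_sub => [|_ [i _ [B mB <-]]]; last by rewrite setTI; exact: HX.
have [H0 HC HU] := sH; split => //.
- by move=> S HS; have := HC _ HS; rewrite setTD setTD preimage_setC.
- by move=> F HF; rewrite /= preimage_bigcup; exact: HU.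
Qed.

Lemma negligible_setY_measure (A B : set Omega) :
  measurable A -> measurable B -> P.-negligible (A `+` B) -> P A = P B.
Proof.
move=> mA mB [N [mN N0 ABN]].
have H A1 B1 : measurable A1 -> measurable B1 -> A1 `+` B1 `<=` N -> (P A1 <= P B1)%E.
  move=> mA1 mB1 AB1; apply: (@le_trans _ _ (P (B1 `|` N))).
    apply: le_measure; rewrite ?inE//; first exact: measurableU.
    move=> w Aw; have [Bw|nBw] := pselect (B1 w); [by left|right].
    by apply: AB1; left.
  by apply: le_trans (measureU2 _ _ _) _ => //; rewrite [X in (_ + X)%E]N0 adde0.
apply/eqP; rewrite eq_le !H //; rewrite setYC //.
Qed.

End SigmaAlgebras.

Lemma xsectionE (T1 T2 : Type) (S : set (T1 * T2)) x :
  xsection S x = [set y | S (x, y)].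
Proof. by apply/seteqP; split=> y; [move=> /set_mem|move=> ?; exact/mem_set]. Qed.

Section Freezing.
Context (R : realType) d (Omega : measurableType d) (P : probability Omega R).
Context d1 (T1 : measurableType d1) d2 (T2 : measurableType d2).
Variable nu : probability T2 R.

(** Freezing: when V is independent of Z, events on (Z, V) are measured by first
    holding Z fixed; this is the uniqueness of product measures. *)
Lemma freeze (Z : Omega -> T1) (V : Omega -> T2) :
  measurable_fun setT Z -> measurable_fun setT V ->
  (forall A B, measurable A -> measurable B ->
     P (Z @^-1` A `&` V @^-1` B) = (P (Z @^-1` A) * nu B)%E) ->
  forall S : set (T1 * T2), measurable S ->
  P [set w | S (Z w, V w)] = (\int[P]_w nu (xsection S (Z w)))%E.
Proof.
move=> mZ mV ZV S mS.
pose Zf : {mfun Omega >-> T1} := HB.pack Z (isMeasurableFun.Build _ _ _ _ _ mZ).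
pose ZVf : {mfun Omega >-> (T1 * T2)%type} :=
  HB.pack (fun w => (Z w, V w))
   (isMeasurableFun.Build _ _ _ _ _ (measurable_fun_pair mZ mV)).
transitivity (distribution P ZVf S) => //.
rewrite -(@product_measure_unique _ _ _ _ _ (distribution P Zf) nu) //.
rewrite /= /product_measure1 ge0_integral_pushforward //.
exact: measurable_fun_xsection.
Qed.
End Freezing.

Section FreezingSigma.
Context (R : realType) d (Omega : measurableType d) (P : probability Omega R).
Context d1 (T1 : measurableType d1) d2 (T2 : measurableType d2).
Variable nu : probability T2 R.

(** The event C is carried along by freezing the pair (1_C, Z) in place of Z. *)
Lemma freeze_event (H : set (set Omega)) (Z : Omega -> T1) (V : Omega -> T2) :
  sigma_algebra setT H -> H `<=` measurable ->
  measurable_wrt H Z -> measurable_fun setT V ->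
  (forall D B, H D -> measurable B ->
     P (D `&` V @^-1` B) = (P D * nu B)%E) ->
  forall C (S : set (T1 * T2)), H C -> measurable S ->
  P ([set w | S (Z w, V w)] `&` C) = (\int[P]_(w in C) nu (xsection S (Z w)))%E.
Proof.
move=> sH Hm HZ mV HV C S HC mS.
pose Z' w : bool * T1 := (w \in C, Z w).
have mZ' : measurable_wrt H Z'.
  apply/(measurable_wrtP _ sH)/measurable_fun_pair; last exact/measurable_wrtP.
  apply: (measurable_fun_bool true) => //; rewrite setTI.
  apply: sub_sigma_algebra; rewrite (_ : _ @^-1` _ = C) //.
  by apply/seteqP; split=> w /=; [move=> /set_mem|move=> /mem_set].
pose S' : set ((bool * T1) * T2) := [set z : (bool * T1) * T2 | z.1.1 /\ S (z.1.2, z.2)].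
have mS' : measurable S'.
  rewrite (_ : S' = (fun z => z.1.1) @^-1` [set true] `&`
                    (fun z => (z.1.2, z.2)) @^-1` S) //.
  have m1 : measurable_fun setT (fun z : (bool * T1) * T2 => z.1.1).
    by apply: measurableT_comp; exact: measurable_fst.
  have m2 : measurable_fun setT (fun z : (bool * T1) * T2 => (z.1.2, z.2)).
    apply: measurable_fun_pair; last exact: measurable_snd.
    by apply: measurableT_comp; [exact: measurable_snd|exact: measurable_fst].
  apply: measurableI; first by rewrite -[X in measurable X]setTI; exact: m1.
  by rewrite -[X in measurable X]setTI; exact: m2.
have -> : [set w | S (Z w, V w)] `&` C = [set w | S' (Z' w, V w)].
  apply/seteqP; split=> w; first by move=> [Sw Cw]; split => //=; exact: mem_set.
  by move=> [/set_mem Cw Sw]; split.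
rewrite (@freeze _ _ _ P _ _ _ _ nu Z' V) //.
- rewrite [RHS]integral_mkcond; apply: eq_integral => w _.
  rewrite patchE /xsection /S' /Z' /=.
  case: ifPn => wC.
    congr (nu _); apply/seteqP; split=> v /set_mem /= Sv; apply/mem_set => //=.
    by case: Sv.
  rewrite (_ : [set _ | _] = set0) ?measure0 //; apply/seteqP; split=> v //.
  by move=> /set_mem[wC' _]; move/negP: wC; apply.
- exact: measurable_wrt_fun mZ'.
- by move=> A B mA mB; apply: HV => //; exact: mZ'.
Qed.

End FreezingSigma.

Section CutMeasure.
Context (R : realType) d (Omega : measurableType d) (P : probability Omega R).
Variables (H : set (set Omega)) (C : set Omega).
Hypotheses (sH : sigma_algebra setT H) (Hm : H `<=` measurable).
Hypothesis mC : measurable C.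

(** The density of this measure with respect to P, on the sigma-algebra H, is
    the conditional probability of C. *)
Definition cut_measure of sigma_algebra setT H & H `<=` measurable &
    measurable C : set (g_sigma_algebraType H) -> \bar R :=
  fun D => P (C `&` D).

Local Notation cut := (cut_measure sH Hm mC).

Let sub_measurable (D : set (g_sigma_algebraType H)) :
  measurable D -> measurable (D : set Omega).
Proof. by rewrite {1}/measurable /= sigma_algebra_id //; exact: Hm. Qed.

Let cut0 : cut set0 = 0%E. Proof. by rewrite /cut_measure setI0 measure0. Qed.

Let cut_ge0 D : (0 <= cut D)%E. Proof. exact: measure_ge0. Qed.

Let cut_additive : semi_sigma_additive cut.
Proof.
move=> F mF tF mUF; rewrite /cut_measure setI_bigcupr.
apply: measure_semi_sigma_additive.
- by move=> n; apply: measurableI => //; exact: sub_measurable.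
- exact: trivIset_setIl.
- by rewrite -setI_bigcupr; apply: measurableI => //; exact: sub_measurable.
Qed.

HB.instance Definition _ := isMeasure.Build _ _ _ cut cut0 cut_ge0 cut_additive.

Let cut_fin : fin_num_fun cut.
Proof.
by move=> D mD; apply: fin_num_measure; apply: measurableI => //; exact: sub_measurable.
Qed.

HB.instance Definition _ := Measure_isFinite.Build _ _ _ cut cut_fin.
End CutMeasure.

Section Conditioning.
Context (R : realType) d (Omega : measurableType d) (P : probability Omega R).
Variable H : set (set Omega).
Hypotheses (sH : sigma_algebra setT H) (Hm : H `<=` measurable).

Let T := g_sigma_algebraType H.

Let H_measurable (D : set Omega) : H D -> measurable (D : set T).
Proof. by move=> HD; exact: sub_sigma_algebra. Qed.

Let measurable_H (D : set T) : measurable D -> H D.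
Proof. by rewrite /measurable /= sigma_algebra_id. Qed.

Let HI D1 D2 : H D1 -> H D2 -> H (D1 `&` D2).
Proof. by move=> h1 h2; apply/measurable_H/measurableI; exact: H_measurable. Qed.

Let mH d' (E : measurableType d') (Y : Omega -> E) :
  measurable_fun setT (Y : T -> E) -> measurable_fun setT Y.
Proof. by move=> /(measurable_wrtP _ sH); exact: measurable_wrt_fun. Qed.

Import HBNNSimple.

(** For the indicator of an event of H this is the definition of conditional
    probability; linearity and monotone convergence do the rest. *)
Lemma take_out (C : set Omega) (g : Omega -> R) (h : Omega -> \bar R) :
  measurable C -> (forall w, 0 <= g w) -> measurable_fun setT g ->
  (forall D, H D -> (\int[P]_(w in D) (g w)%:E)%E = P (C `&` D)) ->
  (forall w, 0 <= h w)%E -> measurable_fun setT (h : T -> \bar R) ->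
  forall D, H D ->
  (\int[P]_(w in D) (h w * (g w)%:E) = \int[P]_(w in C `&` D) h w)%E.
Proof.
move=> mC g0 mg gC h0 mh D HD.
have mD := Hm HD; have mCD : measurable (C `&` D) by exact: measurableI.
have TT : measurable [set: T] by [].
have mgE : measurable_fun setT (EFin \o g) by exact/measurable_EFinP.
pose k := nnsfun_approx TT mh.
have mk n : measurable_fun setT (EFin \o k n : Omega -> \bar R).
  by apply: mH; apply/measurable_EFinP.
have kh w : (k n w)%:E @[n --> \oo] --> h w by exact: cvg_nnsfun_approx.
have ndk w : {homo (fun n => (k n w)%:E) : n m / (n <= m)%N >-> (n <= m)%E}.
  by move=> n m nm; rewrite lee_fin; exact/lefP/nd_nnsfun_approx.
have -> : (\int[P]_(w in D) (h w * (g w)%:E) =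
    limn (fun n => \int[P]_(w in D) ((k n w)%:E * (g w)%:E)))%E.
  rewrite -monotone_convergence //.
  - apply: eq_integral => w _; apply/esym.
    by apply: cvg_lim => //; apply: cvgeZr.
  - move=> n; apply: emeasurable_funM; apply: measurable_funTS; [exact: mk|exact: mgE].
  - by move=> n w _; rewrite mule_ge0 // lee_fin.
  - by move=> w _ n m nm; apply: lee_wpmul2r; [rewrite lee_fin|apply: ndk].
have -> : (\int[P]_(w in C `&` D) h w =
    limn (fun n => \int[P]_(w in C `&` D) (k n w)%:E))%E.
  rewrite -monotone_convergence //.
  - by apply: eq_integral => w _; apply/esym; apply: cvg_lim.
  - by move=> n; apply: measurable_funTS; exact: mk.
  - by move=> n w _; rewrite lee_fin.
congr (lim (_ @ \oo)); apply/funext => n.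
have Hk y : H (k n @^-1` [set y]) by apply: measurable_H; exact: measurable_sfunP.
have kE w : (k n w)%:E = (\sum_(y \in range (k n)) (y * \1_(k n @^-1` [set y]) w)%:E)%E.
  by rewrite fsumEFin // -(fimfunE (k n) w).
have ind0 y w : (0 <= (y * \1_(k n @^-1` [set y]) w)%:E)%E.
  exact: (nnfun_muleindic_ge0 (k n)).
have mind y : measurable_fun setT (fun w : Omega => (y * \1_(k n @^-1` [set y]) w)%:E).
  by apply/measurable_EFinP; apply: measurable_funM => //; exact/measurable_indic/Hm.
under eq_integral do rewrite kE ge0_mule_fsuml //.
under [RHS]eq_integral do rewrite kE.
rewrite !ge0_integral_fsum //; last 3 first.
- by move=> y; apply: measurable_funTS; exact: mind.
- move=> y; apply: emeasurable_funM; apply: measurable_funTS; [exact: mind|exact: mgE].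
- by move=> y w _; rewrite mule_ge0 // lee_fin.
apply: eq_fsbigr => y /set_mem[w0 _ ky].
have y0 : (0 <= y) by rewrite -ky.
under eq_integral do rewrite EFinM -muleA.
under [RHS]eq_integral do rewrite EFinM.
rewrite !ge0_integralZl //.
- congr (_ * _)%E; rewrite integral_indic //; last exact/Hm.
  rewrite [in RHS]setIC -setIA -[RHS]gC; last exact: HI.
  rewrite integral_mkcondr; apply: eq_integral => w _.
  by rewrite epatch_indic muleC.
- apply: emeasurable_funM; apply: measurable_funTS; last exact: mgE.
  exact/measurable_EFinP/measurable_indic/Hm.
- by move=> w _; rewrite mule_ge0 // lee_fin.
- apply: measurable_funTS; exact/measurable_EFinP/measurable_indic/Hm.
Qed.

Lemma cond_prob_exists (C : set Omega) : measurable C ->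
  exists2 g : Omega -> R, (forall w, 0 <= g w) & cond_prob P H C g.
Proof.
move=> mC.
have mid : measurable_fun setT (id : Omega -> T).
  by move=> _ D /measurable_H HD; rewrite setTI preimage_id; exact: Hm.
pose idT : {mfun Omega >-> T} := HB.pack (id : Omega -> T)
  (isMeasurableFun.Build _ _ _ _ _ mid).
pose mu : probability T R := distribution P idT.
pose nu1 : {finite_measure set T -> \bar R} := cut_measure P sH Hm mC.
have nu1mu : nu1 `<< mu.
  move=> N N0 D mD DN; have := N0 D mD DN.
  rewrite /nu1 /cut_measure /mu /distribution /pushforward /=.
  have mD' : measurable (D : set Omega) by exact/Hm/measurable_H.
  move=> D0; apply: (@subset_measure0 _ _ _ P (C `&` D) D) => //.
  exact: measurableI.
pose f := Radon_Nikodym_SigmaFinite.f nu1 mu.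
have f0 w : (0 <= f w)%E by exact: Radon_Nikodym_SigmaFinite.f_ge0.
have ff w : f w \is a fin_num by exact: Radon_Nikodym_SigmaFinite.f_fin_num.
have mf : measurable_fun [set: T] f.
  exact: measurable_int (Radon_Nikodym_SigmaFinite.f_integrable _).
have mg : measurable_fun [set: T] (fine \o f) by exact: measurableT_comp.
have gE D : H D -> (\int[P]_(w in D) (fine (f w))%:E)%E = P (C `&` D).
  move=> HD; transitivity (nu1 D); last by [].
  rewrite (Radon_Nikodym_SigmaFinite.f_integral nu1mu); last exact: H_measurable.
  rewrite ge0_integral_pushforward //=; [|exact: H_measurable|exact: measurable_funTS].
  by apply: eq_integral => w _; rewrite /= fineK.
exists (fine \o f); first by move=> w; exact: fine_ge0.
split => //; first exact/measurable_wrtP.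
have HT : H setT by have := sigma_algebraC; case: sH => h0 /(_ _ h0); rewrite setD0.
apply/integrableP; split; first by apply/measurable_EFinP; exact: mH.
under eq_integral do rewrite /= ger0_norm ?fine_ge0 //.
by rewrite gE // (le_lt_trans (probability_le1 _ _)) ?ltry // setIT.
Qed.

(** A version of P(A | H) that integrates correctly against the larger
    sigma-algebra G expresses that A and G are independent given H. *)
Lemma cond_independent_intro (F G : set (set Omega)) :
  sigma_algebra setT G -> G `<=` measurable -> H `<=` G -> F `<=` measurable ->
  (forall A, F A -> exists f : Omega -> R,
     [/\ measurable_wrt H f, forall w, 0 <= f w <= 1 &
         forall C, G C -> (\int[P]_(w in C) (f w)%:E)%E = P (A `&` C)]) ->
  cond_independent P H F G.
Proof.
move=> sG Gm HG Fm HF A B FA GB.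
have [f [Hf f01 fE]] := HF A FA; have mA := Fm A FA; have mB := Gm B GB.
have [g g0 [Hg gi gE]] := cond_prob_exists mB.
have mf : measurable_fun setT f by exact: measurable_wrt_fun Hf.
have mg : measurable_fun setT g by exact: measurable_wrt_fun Hg.
have GI : H setT by case: sH => h0 /(_ _ h0); rewrite setD0.
have fgE D : H D -> (\int[P]_(w in D) (f w * g w)%:E)%E = P (A `&` B `&` D).
  move=> HD; under eq_integral do rewrite EFinM.
  rewrite (@take_out B g (EFin \o f)) //; last 2 first.
  - by move=> w; rewrite lee_fin; case/andP: (f01 w).
  - by apply/measurable_EFinP; exact/measurable_wrtP.
  rewrite -setIA -[RHS]fE //.
  pose TG := g_sigma_algebraType G.
  have : measurable (B `&` D : set TG).
    by apply: measurableI; apply: sub_sigma_algebra => //; exact: HG.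
  by rewrite /measurable /= sigma_algebra_id.
exists f, g; split => //.
  split => //.
    apply: measurable_bounded_integrable => //.
      by rewrite (le_lt_trans (probability_le1 _ _)) ?ltry.
    exists 1; split=> // x x1 w _; rewrite /= ger0_norm; last by case/andP: (f01 w).
    by apply: le_trans (ltW x1); case/andP: (f01 w).
  by move=> C HC; apply: fE; exact: HG.
split => //.
- apply/(measurable_wrtP _ sH)/measurable_funM; exact/measurable_wrtP.
- apply/integrableP; split; first by apply/measurable_EFinP; exact: measurable_funM.
  under eq_integral.
    move=> w _; rewrite /= ger0_norm; last by rewrite mulr_ge0 //; case/andP: (f01 w).
    over.
  rewrite fgE // (le_lt_trans (probability_le1 _ _)) ?ltry // setIT.
  exact: measurableI.
Qed.
End Conditioning.

(** * A coalescing update rule *)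

Section Automaton.
Variable A : finZmodType.
Implicit Types (x y z v : config A) (i j : int) (m n L : nat).

Definition config_add x y : config A := fun i => x i + y i.

Lemma iter_tauS m x j :
  iter m.+1 (@tau A) x j = iter m (@tau A) x j + iter m (@tau A) x (j + 1).
Proof. by []. Qed.

Lemma iter_tau_add m x y j :
  iter m (@tau A) (config_add x y) j = iter m (@tau A) x j + iter m (@tau A) y j.
Proof. by elim: m j => [//|m IH] j; rewrite !iter_tauS !IH addrACA. Qed.

Lemma iter_tau_local m x y j :
  (forall i, j <= i <= j + m%:Z -> x i = y i) ->
  iter m (@tau A) x j = iter m (@tau A) y j.
Proof.
elim: m j => [|m IH] j xy; first by apply: xy; lia.
by rewrite !iter_tauS !IH // => i ij; apply: xy; lia.
Qed.

(** The letter of x at j enters its m-th image at j with coefficient one. *)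
Lemma iter_tau_diag m x y j : (forall i, j < i -> x i = y i) ->
  iter m (@tau A) x j - x j = iter m (@tau A) y j - y j.
Proof.
move=> xy; elim: m => [|m IH]; first by rewrite !subrr.
rewrite !iter_tauS addrAC IH [RHS]addrAC; congr (_ + _).
by apply: iter_tau_local => i ij; apply: xy; lia.
Qed.

(** A configuration serves as a family of letters indexed by a letter and a
    site, through an injective numbering. *)
Definition slot (a : A) (j : int) : int := Posz (choice.pickle (a, j)).

Lemma slot_inj a b i j : slot a i = slot b j -> a = b /\ i = j.
Proof. by move=> [/(pcan_inj choice.pickleK)[-> ->]]. Qed.

(** The value at j that the m-th image of tau x + xi would have if xi vanished
    at j; it involves the sites to the right of j only. *)
Definition predicted m x (xi : config A) j : A :=
  iter m (@tau A) (config_add (tau x) (fun i => if j < i then xi i else 0)) j.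

(** The window [[-L, L]] is filled from right to left, as the predicted value at
    a site needs the noise at the sites on its right.  The noise at j is then
    the entry of v at j that this predicted value selects; outside the window
    the entry is always the one labelled 0. *)
Fixpoint sweep m L x v n : config A :=
  if n is n'.+1 then
    let j := L%:Z - n'%:Z in
    fun i => if i == j
             then v (slot (iter m (@tau A) (config_add (tau x) (sweep m L x v n')) j) j)
             else sweep m L x v n' i
  else fun i => if (`|i| <= L)%N then 0 else v (slot 0 i).

Definition noise m L x v : config A := sweep m L x v (L + L).+1.

Lemma sweep_outside m L x v n i : (n <= (L + L).+1)%N -> (L < `|i|)%N ->
  sweep m L x v n i = v (slot 0 i).
Proof.
elim: n => [|n IH] nL iL /=; first by rewrite leqNgt iL.
by case: eqP => [?|_]; [lia|rewrite IH //; lia].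
Qed.

Lemma sweep_pending m L x v n i :
  (`|i| <= L)%N -> i + n%:Z <= L%:Z -> sweep m L x v n i = 0.
Proof.
elim: n => [|n IH] iL iLn /=; first by rewrite iL.
by case: eqP => [?|_]; [lia|rewrite IH //; lia].
Qed.

Lemma sweep_done m L x v n n' i :
  (n <= n')%N -> L%:Z < i + n%:Z -> sweep m L x v n' i = sweep m L x v n i.
Proof.
elim: n' => [|n' IH] nn' iLn; first by have -> : n = 0%N by lia.
have [->//|nn''] := eqVneq n n'.+1.
by rewrite /=; case: eqP => [?|_]; [lia|rewrite IH //; lia].
Qed.

Lemma noise_outside m L x v j : (L < `|j|)%N -> noise m L x v j = v (slot 0 j).
Proof. exact: sweep_outside. Qed.

(** The sites left of j do not matter for the value at j, and those right of j
    have their final noise when j is filled. *)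
Lemma noise_inside m L x v j : (`|j| <= L)%N ->
  noise m L x v j = v (slot (predicted m x (noise m L x v) j) j).
Proof.
move=> jL; pose n := `|L%:Z - j|%N.
have jE : j = L%:Z - n%:Z by lia.
rewrite {1}/noise (@sweep_done _ _ _ _ n.+1); [|lia..].
rewrite /= -jE eqxx; congr (v (slot _ _)).
have -> : iter m (@tau A) (config_add (tau x) (sweep m L x v n)) j =
    iter m (@tau A) (config_add (tau x) (fun i => if j < i then sweep m L x v n i else 0)) j.
  rewrite !(iter_tau_add _ (tau x)); congr (_ + _).
  have := @iter_tau_diag m (sweep m L x v n)
    (fun i => if j < i then sweep m L x v n i else 0) j.
  rewrite ltxx subr0 sweep_pending ?subr0; [|lia..].
  by apply=> i ->.
rewrite /predicted; congr (iter _ _ _ _); apply/funext => i; rewrite /config_add.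
by case: ltP => // ji; rewrite /noise (@sweep_done _ _ _ _ n) //; lia.
Qed.

Lemma predicted_local m x y z j :
  (forall i, j < i <= j + m%:Z -> y i = z i) ->
  predicted m x y j = predicted m x z j.
Proof.
move=> yz; apply: iter_tau_local => i ij; rewrite /config_add; congr (_ + _).
by case: ltP => // ji; apply: yz; rewrite ji; case/andP: ij.
Qed.

(** On a long enough interval, prescribing the noise prescribes which entries
    of v it reads; these entries lie at distinct places. *)
Lemma noise_cyl m L x v n y : (L + m <= n)%N ->
  cyl n y (noise m L x v) <->
  forall j, (`|j| <= n)%N ->
    v (slot (if (`|j| <= L)%N then predicted m x y j else 0) j) = y j.
Proof.
move=> Ln; split=> [ny j jn|vy].
  rewrite -(ny j jn); case: ifPn => jL; last by rewrite noise_outside // ltnNge.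
  rewrite noise_inside //; congr (v (slot _ _)); apply: predicted_local => i ij.
  by rewrite ny //; lia.
suff H k j : (`|j| <= n)%N -> n%:Z - j < k%:Z -> noise m L x v j = y j.
  by move=> j jn; apply: (H `|n%:Z - j|.+1 j jn); lia.
elim: k j => [|k IH] j jn jk; first by lia.
rewrite -(vy j jn); case: ifPn => jL; last by rewrite noise_outside // ltnNge.
rewrite noise_inside //; congr (v (slot _ _)); apply: predicted_local => i ij.
by apply: IH; lia.
Qed.

Definition step m L x v : config A := config_add (tau x) (noise m L x v).

Lemma iter_tau_step m L x v j :
  iter m (@tau A) (step m L x v) j =
  predicted m x (noise m L x v) j + noise m L x v j.
Proof.
have := @iter_tau_diag m (noise m L x v)
  (fun i => if j < i then noise m L x v i else 0) j.
rewrite ltxx subr0 => H; rewrite /predicted !(iter_tau_add _ (tau x)) -[RHS]addrA; congr (_ + _).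
by rewrite -H ?subrK // => i ->.
Qed.

(** All the entries that might be selected at a site of the window cancel the
    predicted value selecting them.  This has positive probability, however
    small, and makes the image independent of the current configuration. *)
Definition success L v : Prop :=
  forall (a : A) j, (`|j| <= L)%N -> v (slot a j) = - a.

Lemma success_step m L x v j : success L v -> (`|j| <= L)%N ->
  iter m (@tau A) (step m L x v) j = 0.
Proof.
by move=> sv jL; rewrite iter_tau_step noise_inside // sv // subrr.
Qed.

(** The noise consults x through the predicted values only, that is, through
    the m.+1-st image of x on the window. *)
Lemma noise_eq m L x y v :
  (forall j, (`|j| <= L)%N -> iter m.+1 (@tau A) x j = iter m.+1 (@tau A) y j) ->
  noise m L x v = noise m L y v.
Proof.
move=> xy; apply/funext; rewrite /noise.
have : ((L + L).+1 <= (L + L).+1)%N by [].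
elim: {1 3 4}(L + L).+1 => [//|n IH] nL i /=.
have {}IH : sweep m L x v n = sweep m L y v n by apply/funext/IH; lia.
rewrite IH; case: eqP => // _; congr (v (slot _ _)).
rewrite (iter_tau_add _ (tau x)) (iter_tau_add _ (tau y)); congr (_ + _).
by rewrite -!iterSr; apply: xy; lia.
Qed.

Lemma iter_tau_step_eq m L x y v :
  (forall j, (`|j| <= L)%N -> iter m.+1 (@tau A) x j = iter m.+1 (@tau A) y j) ->
  forall j, (`|j| <= L)%N ->
  iter m (@tau A) (step m L x v) j = iter m (@tau A) (step m L y v) j.
Proof.
move=> xy j jL; rewrite /step (iter_tau_add _ (tau x)) (iter_tau_add _ (tau y)).
by rewrite (noise_eq _ xy) -!iterSr xy.
Qed.

End Automaton.

(** * The schedule of blocks *)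

Section Schedule.
Variable A : finZmodType.
Variable duration : nat -> nat -> nat.
Hypothesis duration_gt0 : forall L r, (0 < duration L r)%N.

(** Block r consists of the steps k with [block_start r <= k < block_start r.+1],
    and controls the sites of [[- width r, width r]].  Time runs towards 0, so
    that the blocks r' < r come later; the width of block r exceeds all that
    they can consult. *)
Fixpoint block (r : nat) : nat * nat :=
  if r is r'.+1 then
    let N := ((block r').1 + duration (block r').2 r')%N in
    (N, ((block r').2 + N).+1)
  else (0%N, 0%N).

Definition block_start r := (block r).1.
Definition width r := (block r).2.

Lemma block_startS r : block_start r.+1 = (block_start r + duration (width r) r)%N.
Proof. by []. Qed.

Lemma widthS r : width r.+1 = (width r + block_start r.+1).+1.
Proof. by []. Qed.

Lemma block_start_lt r : (block_start r < block_start r.+1)%N.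
Proof. by rewrite block_startS; have := duration_gt0 (width r) r; lia. Qed.

Lemma leq_block_start r s : (r <= s)%N -> (block_start r <= block_start s)%N.
Proof.
elim: s => [|s IH]; first by rewrite leqn0 => /eqP->.
rewrite leq_eqVlt => /orP[/eqP->//|rs].
exact: leq_trans (IH rs) (ltnW (block_start_lt s)).
Qed.

Lemma leq_index_block_start r : (r <= block_start r)%N.
Proof. by elim: r => // r IH; apply: leq_ltn_trans IH (block_start_lt r). Qed.

Lemma width_reach s r : (s < r)%N -> (width s + block_start r <= width r)%N.
Proof.
elim: r => // r IH; rewrite ltnS leq_eqVlt => /orP[/eqP->|/IH sr].
  by rewrite widthS.
by rewrite widthS; lia.
Qed.

Lemma width_margin r : (r + block_start r <= width r)%N.
Proof.
elim: r => // r IH; rewrite widthS; lia.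
Qed.

Lemma block_exists k : exists r, (k < block_start r.+1)%N.
Proof. by exists k; exact: leq_trans (leq_index_block_start k.+1). Qed.

Definition block_of k : nat := ex_minn (block_exists k).

Lemma block_of_end k : (k < block_start (block_of k).+1)%N.
Proof. by rewrite /block_of; case: ex_minnP. Qed.

Lemma block_of_start k : (block_start (block_of k) <= k)%N.
Proof.
rewrite /block_of; case: ex_minnP => -[//|r] _ r_min.
by rewrite leqNgt; apply/negP => /r_min; rewrite ltnn.
Qed.

Lemma block_of_eq k r :
  (block_start r <= k < block_start r.+1)%N -> block_of k = r.
Proof.
case/andP=> rk kr; have := block_of_end k; have := block_of_start k.
case: (ltngtP (block_of k) r) => // [kr'|rk'] h1 h2.
  by have := leq_block_start kr'; lia.
by have := leq_block_start rk'; lia.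
Qed.

(** The number of steps left before the end of the block is the exponent m of
    the predictions. *)
Definition kstep k (x v : config A) : config A :=
  step (k - block_start (block_of k)) (width (block_of k)) x v.

(** [run d k x V] is the configuration at time -k of the chain started from x
    at time -(k + d). *)
Fixpoint run d k (x : config A) (V : nat -> config A) : config A :=
  if d is d'.+1 then kstep k (run d' k.+1 x V) (V k) else x.

Definition good r (V : nat -> config A) : Prop :=
  exists2 k, (block_start r <= k < block_start r.+1)%N & success (width r) (V k).

(** Success at k0 makes the predictions for the end of the block vanish whatever
    the configuration; equal predictions give equal noise, and hence stay equal
    until the end of the block. *)
Let coalesce_in_block r V k0 n k d d' x x' : (n + k = k0)%N ->
  (block_start r <= k)%N -> (k0 < block_start r.+1)%N -> success (width r) (V k0) ->
  (k0 < k + d)%N -> (k0 < k + d')%N -> forall j, (`|j| <= width r)%N ->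
  iter (k - block_start r) (@tau A) (run d k x V) j =
  iter (k - block_start r) (@tau A) (run d' k x' V) j.
Proof.
move=> + rk k0r sV; elim: n k rk d d' => [|n IH] k rk d d' nk kd kd' j jr;
  (have bk : block_of k = r by apply: block_of_eq; lia);
  case: d kd => [|d] kd; try lia; case: d' kd' => [|d'] kd'; try lia.
  by rewrite /= /kstep bk; have -> : k = k0 by []; rewrite !success_step.
rewrite /= /kstep bk; apply: iter_tau_step_eq => // i ir.
have -> : (k - block_start r).+1 = (k.+1 - block_start r)%N by lia.
by apply: IH => //; lia.
Qed.

(** The interval of agreement loses one site on the right at each step after the
    block; being wider than what the later blocks consult, it gives both runs
    the same noise. *)
Let agree_after_block r V n k d d' x x' : (n + k = block_start r)%N ->
  good r V -> (block_start r.+1 <= k + d)%N -> (block_start r.+1 <= k + d')%N ->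
  forall j, - (width r)%:Z <= j -> j + n%:Z <= (width r)%:Z ->
  run d k x V j = run d' k x' V j.
Proof.
move=> + [k0 k0r sV]; elim: n k d d' => [|n IH] k d d' nk kd kd' j jr1 jr2.
  have H := @coalesce_in_block r V k0 (k0 - k) k d d' x x'.
  have kr : k = block_start r by [].
  move: H; rewrite kr subnn; apply=> //; lia.
have rr := block_start_lt r.
case: d kd => [|d] kd; first by lia.
case: d' kd' => [|d'] kd'; first by lia.
have {}IH i : - (width r)%:Z <= i -> i + n%:Z <= (width r)%:Z ->
    run d k.+1 x V i = run d' k.+1 x' V i by apply: IH; lia.
have h1 := block_of_start k; have h2 := block_of_end k.
have sr : (block_of k < r)%N.
  by rewrite ltnNge; apply/negP => /leq_block_start; lia.
have wr := width_reach sr.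
rewrite /= /kstep /step /config_add; congr (_ + _).
  by rewrite /tau !IH //; lia.
rewrite (@noise_eq _ _ _ _ (run d' k.+1 x' V)) // => i iw.
by apply: iter_tau_local => l il; apply: IH; lia.
Qed.

(** The two previous facts, near the origin: the margin of [width] outlasts the
    shrinking of the interval of agreement. *)
Lemma run_coalesce r V k d d' x x' j : good r V -> (k <= block_start r)%N ->
  (block_start r.+1 <= k + d)%N -> (block_start r.+1 <= k + d')%N ->
  (`|j| <= r)%N -> run d k x V j = run d' k x' V j.
Proof.
move=> gV kr kd kd' jr; have wr := width_margin r.
by apply: (@agree_after_block r V (block_start r - k)) => //; lia.
Qed.

Lemma run_eq d k x V V' : (forall i, (k <= i < k + d)%N -> V i = V' i) ->
  run d k x V = run d k x V'.
Proof.
elim: d k => //= d IH k VV'; rewrite IH ?VV' // => [|i ik]; first lia.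
by apply: VV'; lia.
Qed.

Lemma good_eq r V V' : (forall i, (i < block_start r.+1)%N -> V i = V' i) ->
  good r V -> good r V'.
Proof.
by move=> VV' [k kr sV]; exists k => //; rewrite -VV' //; case/andP: kr.
Qed.

End Schedule.

(** * The update rule preserves the law of the noise *)

Section Noise.
Variables (R : realType) (A : finZmodType) (p : A -> R).
Variable nu : probability (config A) R.
Hypothesis nu_iid : iid_coordinates p nu.

(** Products over any injectively indexed family of sites, not over sets of
    sites only: the noise reads letters at places that are distinct but given
    by a formula. *)
Lemma iid_sites (I : eqType) (f : I -> int) (y : I -> A) (s : seq I) :
  uniq s -> {in s &, injective f} ->
  nu [set v | forall i, i \in s -> v (f i) = y i] = (\prod_(i <- s) p (y i))%:E.
Proof.
move=> us finj; have [indep marg] := nu_iid.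
pose B (k : int) : set (alphabet A) :=
  [set a | forall i, i \in s -> f i = k -> a = y i].
have BE i : i \in s -> B (f i) = [set y i].
  move=> si; apply/seteqP; split=> a /=; first by move=> H; exact: H.
  by move=> -> i' si' /(finj _ _ si' si) ->.
have mB k : measurable (B k) by [].
have := indep [fset k | k in map f s]%fset B mB.
have -> : \bigcap_(k in [set` [fset k | k in map f s]%fset])
    ((fun x : config A => x k) @^-1` B k) =
    [set v | forall i, i \in s -> v (f i) = y i].
  apply/seteqP; split=> v /= vB.
    move=> i si; apply: (vB (f i)) => //=.
    by rewrite !inE map_f.
  by move=> k /=; rewrite !inE => /mapP[i si ->] i' si' /finj ff; rewrite ff // vB.
move=> ->; rewrite (perm_big (map f s)); last first.
  apply: uniq_perm; [exact: fset_uniq|by rewrite map_inj_in_uniq|].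
  by move=> k; rewrite !inE.
rewrite big_map -prodEFin big_seq [RHS]big_seq; apply: eq_bigr => i si.
by rewrite BE // -(marg (f i) (y i)).
Qed.

Definition window (n : nat) : seq int := [seq k%:Z - n%:Z | k <- iota 0 (n + n).+1].

Lemma mem_window n j : (j \in window n) = (`|j| <= n)%N.
Proof.
apply/mapP/idP => [[k]|jn]; first by rewrite mem_iota => ? ->; lia.
by exists `|(j + n%:Z)%R|%N; rewrite ?mem_iota; lia.
Qed.

Lemma uniq_window n : uniq (window n).
Proof. by rewrite map_inj_uniq ?iota_uniq // => a b; lia. Qed.

Lemma cyl_window n (y : config A) :
  cyl n y = [set v | forall j, j \in window n -> v j = y j].
Proof.
by apply/seteqP; split=> v vy j; [rewrite mem_window|rewrite -mem_window]; exact: vy.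
Qed.

Lemma measurable_tau : measurable_fun setT (@tau A).
Proof.
apply: measurable_fun_config => i.
by apply: measurable_fun_letter2; exact: measurable_fun_site.
Qed.

Lemma measurable_config_add d (T : measurableType d) (f g : T -> config A) :
  measurable_fun setT f -> measurable_fun setT g ->
  measurable_fun setT (fun t => config_add (f t) (g t)).
Proof.
move=> mf mg; apply: measurable_fun_config => i; apply: measurable_fun_letter2.
  exact: (measurableT_comp (@measurable_fun_site A i) mf).
exact: (measurableT_comp (@measurable_fun_site A i) mg).
Qed.

Lemma measurable_iter_tau d (T : measurableType d) (f : T -> config A) m :
  measurable_fun setT f -> measurable_fun setT (fun t => iter m (@tau A) (f t)).
Proof.
by move=> mf; elim: m => //= m IH; exact: (measurableT_comp measurable_tau IH).
Qed.

Lemma measurable_read d (T : measurableType d) (g : T -> alphabet A)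
    (f : T -> config A) j :
  measurable_fun setT g -> measurable_fun setT f ->
  measurable_fun setT (fun t => f t (slot (g t) j)).
Proof.
move=> mg mf; apply: measurable_fun_letter => a.
rewrite [X in measurable X](_ : _ = \bigcup_(b : A)
   (g @^-1` [set b] `&` [set t | f t (slot b j) = a])).
  apply: fin_bigcup_measurable => [|b _]; first exact: finite_finset.
  apply: measurableI; rewrite -[X in measurable X]setTI; first exact: mg.
  exact: (measurableT_comp (@measurable_fun_site A (slot b j)) mf) measurableT [set a] _.
apply/seteqP; split=> [t ta|t [b _ [gb]]]; first by exists (g t).
by rewrite /preimage /= gb.
Qed.

Lemma measurable_sweep m L n : measurable_fun setT
  (fun z : config A * config A => sweep m L z.1 z.2 n).
Proof.
elim: n => [|n IH] /=; apply: measurable_fun_config => i.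
  case: (`|i| <= L)%N; first exact: measurable_cst.
  exact: (measurableT_comp (@measurable_fun_site A _) measurable_snd).
case: (i == _); last exact: (measurableT_comp (@measurable_fun_site A _) IH).
apply: measurable_read; last exact: measurable_snd.
have H : measurable_fun setT (fun z : config A * config A =>
    iter m (@tau A) (config_add (tau z.1) (sweep m L z.1 z.2 n))).
  apply: measurable_iter_tau; apply: measurable_config_add => //.
  exact: (measurableT_comp measurable_tau measurable_fst).
exact: (measurableT_comp (@measurable_fun_site A _) H).
Qed.

Lemma measurable_noise m L (x : config A) : measurable_fun setT (noise m L x).
Proof. exact: (measurableT_comp (measurable_sweep m L _) (pair1_measurable x)). Qed.

Lemma measurable_step m L : measurable_fun setT
  (fun z : config A * config A => step m L z.1 z.2).
Proof.
apply: measurable_config_add; last exact: measurable_sweep.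
exact: (measurableT_comp measurable_tau measurable_fst).
Qed.

(** Fixing the noise on a long interval means fixing as many distinct letters
    of v, at places that the prescribed values determine. *)
Lemma noise_law m L x B : measurable B -> nu (noise m L x @^-1` B) = nu B.
Proof.
pose noisef : {mfun config A >-> config A} :=
  HB.pack (noise m L x) (isMeasurableFun.Build _ _ _ _ _ (measurable_noise m L x)).
apply: (@config_probability_eq _ _ (L + m) (distribution nu noisef) nu).
move=> n y Ln; rewrite /distribution /pushforward /=.
pose f j := slot (if (`|j| <= L)%N then predicted m x y j else 0) j.
transitivity (nu [set v | forall j, j \in window n -> v (f j) = y j]).
  congr (nu _); apply/seteqP; split=> v.
    by move=> /(noise_cyl _ _ _ Ln) H j; rewrite mem_window; exact: H.
  move=> H; apply/(noise_cyl _ _ _ Ln) => j; rewrite -mem_window; exact: H.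
rewrite cyl_window iid_sites ?uniq_window //; last by move=> i j _ _ /slot_inj[].
by rewrite (@iid_sites _ id) ?uniq_window.
Qed.

Lemma step_law m L x B : measurable B ->
  nu [set v | B (step m L x v)] = tau_kernel nu x B.
Proof.
move=> mB; rewrite /tau_kernel /pushforward -[RHS](@noise_law m L x) //.
have : measurable_fun setT (fun xi : config A => config_add (tau x) xi).
  by apply: measurable_config_add => //; exact: measurable_cst.
by move=> /(_ measurableT B mB); rewrite setTI.
Qed.

Definition success_places L : seq (A * int) := [seq (a, j) | a <- enum A, j <- window L].

Lemma successE L : success L =
  [set v | forall i, i \in success_places L -> v (slot i.1 i.2) = - i.1].
Proof.
apply/seteqP; split=> v sv; last first.
  move=> a j jL; apply: (sv (a, j)); apply/allpairsP; exists (a, j).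
  by rewrite mem_enum mem_window.
move=> _ /allpairsP[[a j] /= [_ jL ->]] /=; apply: sv.
by rewrite -mem_window.
Qed.

Lemma measurable_success L : measurable (success L : set (config A)).
Proof.
rewrite successE; elim: (success_places L) => [|i s IH].
  by rewrite [X in measurable X](_ : _ = setT) //; apply/seteqP; split.
rewrite [X in measurable X](_ : _ = [set v | v (slot i.1 i.2) = - i.1] `&`
   [set v | forall i, i \in s -> v (slot i.1 i.2) = - i.1]).
  apply: measurableI => //.
  exact: (measurable_site (slot i.1 i.2) (fun a => a = - i.1)).
apply/seteqP; split=> v.
  by move=> H; split=> [|i' i's]; apply: H; rewrite inE ?eqxx // i's orbT.
by move=> [h1 h2] i'; rewrite inE => /orP[/eqP->|/h2].
Qed.

Lemma success_gt0 L : (forall a, 0 < p a) -> (0 < nu (success L))%E.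
Proof.
move=> p0; rewrite successE (@iid_sites _ (fun i => slot i.1 i.2) (fun i => - i.1)).
- by rewrite lte_fin; apply: prodr_gt0.
- by apply: allpairs_uniq; rewrite ?enum_uniq ?uniq_window // => -[? ?] [? ?].
- by move=> [a i] [b j] _ _ /= /slot_inj[-> ->].
Qed.

End Noise.

(** * The chain built from its innovations *)

Section Locality.
Variables (A : finZmodType) (duration : nat -> nat -> nat).
Hypothesis duration_gt0 : forall L r, (0 < duration L r)%N.

Lemma kstep_local k j : exists n, forall x y v : config A,
  cyl n x y -> kstep duration_gt0 k x v j = kstep duration_gt0 k y v j.
Proof.
set r := block_of duration_gt0 k; set m := (k - block_start duration r)%N.
exists (maxn `|j|.+1 (width duration r + m.+1)) => x y v xy.
rewrite /kstep -/r -/m /step /config_add; congr (_ + _).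
  by rewrite /tau !xy //; lia.
rewrite (@noise_eq _ m _ x y) // => i iL; apply: iter_tau_local => l il.
by rewrite xy //; lia.
Qed.

(** The eventual value, as the starting time recedes, of the chain started from
    the null configuration. *)
Definition past_limit (V : nat -> config A) k : config A := fun j =>
  xget 0 [set a | exists d0, forall d, (d0 <= d)%N ->
    run duration_gt0 d k (fun=> 0) V j = a].

Lemma past_limit_unique V k j a d0 :
  (forall d, (d0 <= d)%N -> run duration_gt0 d k (fun=> 0) V j = a) ->
  past_limit V k j = a.
Proof.
move=> da; apply: xget_unique; first by exists d0.
move=> b [d1 db]; rewrite -(da (maxn d0 d1)) ?leq_maxl //.
by rewrite (db (maxn d0 d1)) ?leq_maxr.
Qed.

Lemma past_limit_good V k j r d x : good duration r V ->
  (k <= block_start duration r)%N -> (block_start duration r.+1 <= k + d)%N ->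
  (`|j| <= r)%N -> past_limit V k j = run duration_gt0 d k x V j.
Proof.
move=> gV kr kd jr; apply: (@past_limit_unique _ _ _ _ d) => d' dd'.
by apply: (@run_coalesce _ _ _ r) => //; lia.
Qed.

(** One step depends on finitely many letters, each of which has become
    stationary once the starting time precedes a successful block. *)
Lemma past_limit_step V k : (forall r0, exists2 r, (r0 <= r)%N & good duration r V) ->
  past_limit V k = kstep duration_gt0 k (past_limit V k.+1) (V k).
Proof.
move=> gV; apply/funext => j; have [n nP] := kstep_local k j.
have [r rP gr] := gV (maxn k.+1 (maxn n `|j|)).
have kr := leq_index_block_start duration_gt0 r.
have rr := block_start_lt duration_gt0 r.
pose d := (block_start duration r.+1 - k.+1)%N.
rewrite (@past_limit_good V k j r d.+1 (fun=> 0)) //; [|lia..].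
apply: nP => i iN; apply: (@past_limit_good V k.+1 i r d) => //; lia.
Qed.

End Locality.

Lemma harmonic_lt (R : realType) (e : R) : 0 < e ->
  exists N, forall n, (N <= n)%N -> n.+1%:R^-1 < e.
Proof.
move=> e0; have := @cvg_harmonic R => /cvgrPdist_lt/(_ _ e0)[N _ NP].
exists N => n Nn; have := NP n Nn.
by rewrite sub0r normrN ger0_norm // /harmonic invr_ge0.
Qed.

Section Construction.
Variables (R : realType) (A : finZmodType) (p : A -> R).
Variable nu : probability (config A) R.
Hypothesis nu_iid : iid_coordinates p nu.
Hypothesis p_gt0 : forall a, 0 < p a.

Lemma duration_exists L r : exists T, (0 < T)%N /\
  (1 - fine (nu (success L : set (config A)))) ^+ T <= r.+1%:R^-1.
Proof.
set q := fine _.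
have nuf : nu (success L : set (config A)) \is a fin_num.
  by apply: fin_num_measure; exact: measurable_success.
have q0 : 0 < q by rewrite -lte_fin fineK //; exact: success_gt0 nu_iid _ _.
have q1 : q <= 1.
  by rewrite -lee_fin fineK // probability_le1 //; exact: measurable_success.
have h : `|1 - q| < 1 by rewrite ger0_norm ?subr_ge0 // ltrBlDr ltrDl.
have /cvgrPdist_lt := cvg_geometric 1 h.
have r0 : 0 < (r.+1%:R^-1 : R) by rewrite invr_gt0.
move=> /(_ _ r0)[N _ /(_ N.+1 (leqnSn N))] /=.
rewrite /geometric /= mul1r sub0r normrN ger0_norm ?exprn_ge0 ?subr_ge0 //.
by move=> ?; exists N.+1; split=> //; exact: ltW.
Qed.

(** Long enough for the block to fail with probability at most 1/(r+1). *)
Definition duration L r : nat := sval (cid (duration_exists L r)).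

Lemma duration_gt0 L r : (0 < duration L r)%N.
Proof. by rewrite /duration; case: cid => T []. Qed.

Lemma durationP L r :
  (1 - fine (nu (success L : set (config A)))) ^+ duration L r <= r.+1%:R^-1.
Proof. by rewrite /duration; case: cid => T []. Qed.

Local Notation run := (run duration_gt0).
Local Notation good := (good duration).
Local Notation past_limit := (past_limit duration_gt0).
Local Notation kstep := (kstep duration_gt0).

Lemma measurable_kstep k :
  measurable_fun setT (fun z : config A * config A => kstep k z.1 z.2).
Proof. exact: measurable_step. Qed.

Lemma kstep_law k x B : measurable B ->
  nu [set v | B (kstep k x v)] = tau_kernel nu x B.
Proof. exact: (step_law nu_iid). Qed.

(** V k is the fresh randomness used at time -k: it is known at that time, has
    law nu, and is independent of the previous past. *)
Record innovation d (Omega : measurableType d) (P : probability Omega R)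
    (G : filtration Omega) (V : nat -> Omega -> config A) : Prop := Innovation {
  innovation_sigma : forall k, sigma_algebra setT (G k) ;
  innovation_measurable : forall k, G k `<=` measurable ;
  innovation_past : forall k, G k.+1 `<=` G k ;
  innovation_adapted : forall k, measurable_wrt (G k) (V k) ;
  innovation_indep : forall k D B, G k.+1 D -> measurable B ->
    P (D `&` V k @^-1` B) = (P D * nu B)%E }.

Section Innovation.
Context d (Omega : measurableType d) (P : probability Omega R).
Variables (G : filtration Omega) (V : nat -> Omega -> config A).
Hypothesis GV : innovation P G V.

Local Notation path w := (fun k => V k w).

Lemma innovation_mono k k' : (k <= k')%N -> G k' `<=` G k.
Proof.
elim: k' => [|k' IH]; first by rewrite leqn0 => /eqP->.
rewrite leq_eqVlt => /orP[/eqP->//|kk'].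
exact: subset_trans (innovation_past GV (k:=k')) (IH kk').
Qed.

Lemma run_adapted d' k x : measurable_wrt (G k) (fun w => run d' k x (path w)).
Proof.
have sG i := innovation_sigma GV i.
elim: d' k => [|d' IH] k.
  by apply/(measurable_wrtP _ (sG k)); exact: measurable_cst.
apply/(measurable_wrtP _ (sG k)) => /=.
have H : measurable_fun setT (fun w : g_sigma_algebraType (G k) =>
    (run d' k.+1 x (path w), V k w)).
  apply: measurable_fun_pair; apply/(measurable_wrtP _ (sG k)).
    by move=> B mB; apply: (innovation_past GV); exact: IH.
  exact: (innovation_adapted GV).
exact: (measurableT_comp (@measurable_kstep k) H).
Qed.

Lemma past_limit_adapted k : measurable_wrt (G k) (fun w => past_limit (path w) k).
Proof.
have sG := innovation_sigma GV k; apply/(measurable_wrtP _ sG).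
pose T := g_sigma_algebraType (G k).
apply: measurable_fun_config => j.
have mnz a : a != 0 ->
    measurable ([set w | past_limit (path w) k j = a] : set T).
  move=> a0; rewrite [X in measurable X](_ : _ =
    \bigcup_d0 \bigcap_(d' in [set d' | (d0 <= d')%N])
      [set w | run d' k (fun=> 0) (path w) j = a]).
    apply: bigcupT_measurable => d0; apply: bigcap_measurableType => d' _.
    have /(measurable_wrtP _ sG) H := @run_adapted d' k (fun=> 0).
    have := measurableT_comp (@measurable_fun_site A j) H.
    by move=> /(_ measurableT [set a] Logic.I); rewrite setTI.
  apply/seteqP; split=> w /=; last first.
    by move=> [d0 _ wa]; exact: (@past_limit_unique _ _ _ _ _ _ _ d0).
  rewrite /past_limit; case: xgetP => [b -> [d0 bP] <-|_ a0'].
    by exists d0 => // d' dd'; exact: bP.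
  by rewrite a0' eqxx in a0.
apply: measurable_fun_letter => a.
have [->|a0] := eqVneq a 0; last exact: mnz.
rewrite [X in measurable X](_ : _ =
    ~` \bigcup_(b in [set b | b != 0]) [set w | past_limit (path w) k j = b]).
  apply: measurableC; apply: fin_bigcup_measurable => [|b]; last exact: mnz.
  by apply: (sub_finite_set (@subsetT _ _)); exact: finite_finset.
apply/seteqP; split=> w /=; first by move=> w0 [b /negP b0 wb]; apply: b0; rewrite -wb w0.
move=> H; apply: contrapT => w0; apply: H.
by exists (past_limit (path w) k j) => //; apply/eqP.
Qed.

Let fails L k t : set Omega :=
  [set w | forall i, (k <= i < k + t)%N -> ~ success L (V i w)].

Let failsS L k t : fails L k t.+1 =
  fails L k.+1 t `&` V k @^-1` (~` (success L : set (config A))).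
Proof.
apply/seteqP; split=> w /=.
  by move=> H; split=> [i ik|]; apply: H; lia.
move=> [h1 h2] i ik; have [->//|ki] := eqVneq i k.
by apply: h1; lia.
Qed.

Let fails_known L k t : G k (fails L k t).
Proof.
have sG i := innovation_sigma GV i.
elim: t k => [|t IH] k.
  rewrite (_ : fails L k 0 = setT); last by apply/seteqP; split=> w // _ i; lia.
  by case: (sG k) => h0 /(_ _ h0); rewrite setD0.
rewrite failsS; have : measurable
    (fails L k.+1 t `&` V k @^-1` (~` (success L : set (config A)))
      : set (g_sigma_algebraType (G k))).
  apply: measurableI; apply: sub_sigma_algebra; first exact/(innovation_past GV)/IH.
  by apply: (innovation_adapted GV); apply: measurableC; exact: measurable_success.
by rewrite /measurable /= sigma_algebra_id.
Qed.

(** The step k is the most recent one, so its innovation is independent of all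
    the other steps of the interval. *)
Let fails_prob L k t :
  P (fails L k t) = ((1 - fine (nu (success L : set (config A)))) ^+ t)%:E.
Proof.
elim: t k => [|t IH] k.
  rewrite (_ : fails L k 0 = setT); last by apply/seteqP; split=> w // _ i; lia.
  by rewrite probability_setT expr0.
have mS : measurable (success L : set (config A)) by exact: measurable_success.
rewrite failsS (innovation_indep GV) ?IH //; [|exact: measurableC].
rewrite exprSr EFinM; congr (_ * _)%E; rewrite probability_setC // EFinB fineK //.
exact: fin_num_measure.
Qed.

Let badE r : [set w | ~ good r (path w)] =
  fails (width duration r) (block_start duration r)
    (duration (width duration r) r).
Proof.
apply/seteqP; split=> w /=; first by move=> H i ir si; apply: H; exists i.
by move=> H [i ir]; exact: H.
Qed.

Lemma measurable_bad r : measurable [set w | ~ good r (path w)].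
Proof. by rewrite badE; apply: (innovation_measurable GV); exact: fails_known. Qed.

Lemma bad_le r : (P [set w | ~ good r (path w)] <= (r.+1%:R^-1)%:E)%E.
Proof. by rewrite badE fails_prob lee_fin durationP. Qed.

(** Failure of all the blocks after r0 has probability at most 1/(r+1) for each
    r after r0. *)
Lemma infinitely_often_good :
  {ae P, forall w, forall r0, exists2 r, (r0 <= r)%N & good r (path w)}.
Proof.
apply/ae_foralln => r0; exists (\bigcap_(r in [set r | (r0 <= r)%N]) [set w | ~ good r (path w)]).
have mB : measurable (\bigcap_(r in [set r | (r0 <= r)%N]) [set w | ~ good r (path w)]).
  by apply: bigcap_measurableType => r _; exact: measurable_bad.
split=> //; last first.
  by move=> w /= nw r /= r0r gr; apply: nw; exists r.
apply/eqP; rewrite -measure_le0; apply/lee_addgt0Pr => e e0; rewrite add0e.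
have [N NP] := harmonic_lt e0.
pose r := maxn r0 N.
apply: (@le_trans _ _ (P [set w | ~ good r (path w)])).
  apply: le_measure; rewrite ?inE //; first exact: measurable_bad.
  by move=> w; apply => /=; rewrite leq_maxl.
apply: le_trans (bad_le r) _; by rewrite lee_fin ltW // NP // leq_maxr.
Qed.

Lemma past_limit_step_ae k : {ae P, forall w,
  past_limit (path w) k = kstep k (past_limit (path w) k.+1) (V k w)}.
Proof.
by apply: filterS infinitely_often_good => w /past_limit_step ->.
Qed.

End Innovation.
End Construction.

(** * The chain is Markov, stationary, and immersed *)

Section Chain.
Variables (R : realType) (A : finZmodType) (p : A -> R).
Variable nu : probability (config A) R.
Hypothesis nu_iid : iid_coordinates p nu.
Hypothesis p_gt0 : forall a, 0 < p a.

Local Notation dur := (duration nu_iid p_gt0).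
Local Notation dur_gt0 := (duration_gt0 nu_iid p_gt0).
Local Notation run := (run dur_gt0).
Local Notation good := (good dur).
Local Notation past_limit := (past_limit dur_gt0).
Local Notation kstep := (kstep dur_gt0).
Local Notation paths := (trajectories (fun _ : nat => config A)).

Lemma measurable_coordinate i (B : set (config A)) :
  measurable B -> measurable [set x : paths | B (x i)].
Proof.
by move=> mB; apply: sub_sigma_algebra; exists i => //; exists B => //; rewrite setTI.
Qed.

Lemma measurable_fun_coordinate i : measurable_fun setT (fun x : paths => x i).
Proof. by move=> _ B mB; rewrite setTI; exact: measurable_coordinate. Qed.

Lemma measurable_fun_paths d (T : measurableType d) (f : T -> paths) :
  (forall i, measurable_fun setT (fun t => f t i)) -> measurable_fun setT f.
Proof.
move=> fi; apply: (@measurability _ _ _ _ _ f (cylinders (fun _ : nat => config A))) => //.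
move=> _ [_ [i _ [B mB <-]] <-]; rewrite setTI.
by have := fi i measurableT B mB; rewrite !setTI.
Qed.

Definition path_cons (x : config A) (z : paths) : paths :=
  fun i => if i is i'.+1 then z i' else x.

Lemma measurable_path_cons d (T : measurableType d) (f : T -> config A)
    (g : T -> paths) : measurable_fun setT f -> measurable_fun setT g ->
  measurable_fun setT (fun t => path_cons (f t) (g t)).
Proof.
move=> mf mg; apply: measurable_fun_paths => -[|i] //=.
exact: (measurableT_comp (@measurable_fun_coordinate i) mg).
Qed.

Definition next_event k (S : set paths) : set (paths * config A) :=
  [set z | S (path_cons (kstep k (z.1 0%N) z.2) z.1)].

Lemma measurable_next_event k S : measurable S -> measurable (next_event k S).
Proof.
move=> mS; have H : measurable_fun setT (fun z : paths * config A =>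
    path_cons (kstep k (z.1 0%N) z.2) z.1).
  apply: measurable_path_cons => //.
  have H : measurable_fun setT (fun z : paths * config A => (z.1 0%N, z.2)).
    apply: measurable_fun_pair => //.
    exact: (measurableT_comp (@measurable_fun_coordinate 0) measurable_fst).
  exact: (measurableT_comp (measurable_kstep nu_iid p_gt0 k) H).
by rewrite -[X in measurable X]setTI; exact: H.
Qed.

Section OneChain.
Context d (Omega : measurableType d) (P : probability Omega R).
Variables (G : filtration Omega) (V : nat -> Omega -> config A).
Hypothesis GV : innovation nu P G V.

Definition chain k w : config A := past_limit (fun i => V i w) k.

Definition tail k w : paths := fun i => chain (k + i) w.

Let sG k := innovation_sigma GV k.
Let Gm k : G k `<=` measurable.
Proof. exact: (innovation_measurable GV). Qed.

Lemma chain_adapted k : measurable_wrt (G k) (chain k).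
Proof. exact: past_limit_adapted GV k. Qed.

Lemma measurable_chain k : measurable_fun setT (chain k).
Proof. exact: (measurable_wrt_fun (@Gm k) (@chain_adapted k)). Qed.

Lemma tail_adapted k : measurable_wrt (G k) (tail k).
Proof.
apply/(measurable_wrtP _ (sG k))/measurable_fun_paths => i.
apply/(measurable_wrtP _ (sG k)) => B mB.
by apply: (innovation_mono GV (leq_addr i k)); exact: chain_adapted.
Qed.

Lemma tail0 k w : tail k w 0%N = chain k w.
Proof. by rewrite /tail addn0. Qed.

(** The trajectory ending at time -k is a function of the previous one and of an
    innovation independent of the whole past G k.+1, which is thus frozen. *)
Lemma next_given_past k (S : set paths) C : measurable S -> G k.+1 C ->
  P (tail k @^-1` S `&` C) = (\int[P]_(w in C)
    nu (xsection (next_event k S) (tail k.+1 w)))%E.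
Proof.
move=> mS GC; have mC := Gm GC.
pose Z w := tail k.+1 w.
pose S' := next_event k S; have mS' : measurable S' by exact: measurable_next_event.
have mtail i : measurable_wrt (G i) (tail i) by exact: tail_adapted.
have mV : measurable_fun setT (V k).
  exact: (measurable_wrt_fun (@Gm k) (@innovation_adapted _ _ _ _ _ _ _ _ GV k)).
transitivity (P ([set w | S' (Z w, V k w)] `&` C)).
  apply: negligible_setY_measure.
  - apply: measurableI => //; apply: (@Gm k); exact: mtail.
  - apply: measurableI => //.
    have mZ : measurable_fun setT Z by exact: (measurable_wrt_fun (@Gm k.+1) (mtail k.+1)).
    by have := measurable_fun_pair mZ mV measurableT mS'; rewrite setTI.
  have := past_limit_step_ae nu_iid p_gt0 GV k; apply: negligibleS => w wS /= E.
  have tE : tail k w = path_cons (kstep k (tail k.+1 w 0%N) (V k w)) (tail k.+1 w).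
    apply/funext => -[|i] /=; first by rewrite !tail0.
    by rewrite /tail addSnnS.
  case: wS => -[[h1 h2] h3]; apply: h3; split=> //.
    by rewrite /S' /next_event /Z /= -tE.
  by move: h1; rewrite /S' /next_event /Z /preimage /= -tE.
by rewrite (@freeze_event _ _ _ P _ _ _ _ nu (G k.+1) Z (V k)) //; exact: (innovation_indep GV).
Qed.

Lemma chain_kernel k (B : set (config A)) C : measurable B -> G k.+1 C ->
  P (chain k @^-1` B `&` C) =
  (\int[P]_(w in C) tau_kernel nu (chain k.+1 w) B)%E.
Proof.
move=> mB GC; have mB0 := @measurable_coordinate 0 _ mB.
have := next_given_past mB0 GC; rewrite (_ : _ @^-1` _ = chain k @^-1` B).
  move=> ->; apply: eq_integral => w _; rewrite -(kstep_law nu_iid p_gt0 k) //.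
  congr (nu _); apply/seteqP; split=> v.
    by move=> /set_mem; rewrite /next_event /= tail0.
  by move=> Bv; apply/mem_set; rewrite /next_event /= tail0.
by apply/seteqP; split=> w; rewrite /preimage /= tail0.
Qed.

(** Given all the past innovations, the conditional law of the trajectory
    ending at time -k is a function of the past of the chain alone; adding
    knowledge contained in G cannot change it. *)
Lemma chain_immersed (H : filtration Omega) :
  (forall k, sigma_algebra setT (H k)) -> (forall k, H k `<=` G k) ->
  (forall k, Sigma P chain [set m | (k <= m)%N] `<=` H k) ->
  immersed P (fun k => Sigma P chain [set m | (k <= m)%N]) H.
Proof.
move=> sH HG FH; split=> // k.
have Fm i : Sigma P chain [set m | (i <= m)%N] `<=` measurable.
  by move=> B /FH/HG; exact: Gm.
apply: cond_independent_intro => //; first exact: Sigma_sigma_algebra.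
- by move=> B /HG; exact: Gm.
move=> E FE.
have : Sigma P (fun i => chain (k + i)) setT E.
  move: E FE; apply: Sigma_sub => i ki; have <- : (k + (i - k))%N = i by rewrite subnKC.
  exact: (@Sigma_coordinate _ _ _ _ _ _ _ (fun i => chain (k + i))).
move=> /Sigma_trajectory[S mS ES].
pose S' := next_event k S; have mS' : measurable S' by exact: measurable_next_event.
have nuf w : nu (xsection S' (tail k.+1 w)) \is a fin_num.
  by apply: fin_num_measure; exact: measurable_xsection.
exists (fun w => fine (nu (xsection S' (tail k.+1 w)))); split.
- apply/(measurable_wrtP _ (Sigma_sigma_algebra _ _ _)).
  have mtail : measurable_fun setT
      (tail k.+1 : g_sigma_algebraType (Sigma P chain [set m | (k.+1 <= m)%N]) -> paths).
    apply: measurable_fun_paths => i.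
    apply/(measurable_wrtP _ (Sigma_sigma_algebra _ _ _)).
    by apply: (@Sigma_coordinate _ _ _ P _ _ _ chain _ (k.+1 + i)%N); rewrite /= leq_addr.
  apply: measurableT_comp => //.
  exact: (measurableT_comp (measurable_fun_xsection nu mS') mtail).
- move=> w; rewrite fine_ge0 //= -lee_fin fineK // probability_le1 //.
  exact: measurable_xsection.
move=> C HC; have mC : measurable C by apply: (@Gm k.+1); exact: HG.
have mE : measurable E by exact: Fm FE.
transitivity (P (tail k @^-1` S `&` C)).
  by rewrite next_given_past //; [apply: eq_integral => w _; rewrite fineK|exact: HG].
have mt : measurable (tail k @^-1` S) by apply: (@Gm k); exact: tail_adapted.
apply: negligible_setY_measure; [exact: measurableI|exact: measurableI|].
rewrite setYC; apply: negligibleS ES.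
by move=> w [[[h1 h2] h3]|[[h1 h2] h3]]; [left|right]; split=> // h4; apply: h3.
Qed.

End OneChain.
End Chain.

Section Stationary.
Variables (R : realType) (A : finZmodType) (p : A -> R).
Variable nu : probability (config A) R.
Hypothesis nu_iid : iid_coordinates p nu.
Hypothesis p_gt0 : forall a, 0 < p a.
Variable mu : probability (config A) R.
Hypothesis mu_invariant : forall B, measurable B ->
  (\int[mu]_x tau_kernel nu x B)%E = mu B.

Local Notation dur_gt0 := (duration_gt0 nu_iid p_gt0).
Local Notation run := (run dur_gt0).
Local Notation kstep := (kstep dur_gt0).
Local Notation chain := (chain nu_iid p_gt0).

Lemma tau_kernel_ge0 x B : (0 <= tau_kernel nu x B)%E.
Proof. by rewrite /tau_kernel /pushforward measure_ge0. Qed.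

Lemma measurable_tau_kernel B : measurable B ->
  measurable_fun setT (fun x => tau_kernel nu x B).
Proof.
move=> mB; pose S : set (config A * config A) := [set z | B (config_add (tau z.1) z.2)].
have mS : measurable S.
  have H : measurable_fun setT
      (fun z : config A * config A => config_add (tau z.1) z.2).
    apply: measurable_config_add => //.
    exact: (measurableT_comp (@measurable_tau A) measurable_fst).
  by rewrite -[X in measurable X]setTI; exact: H.
apply: (eq_measurable_fun (nu \o xsection S)); last exact: measurable_fun_xsection.
by move=> x _; rewrite /= xsectionE.
Qed.

Context d (Omega : measurableType d) (P : probability Omega R).
Variables (G : filtration Omega) (V : nat -> Omega -> config A).
Hypothesis GV : innovation nu P G V.

Local Notation path w := (fun k => V k w).

Let mV k : measurable_fun setT (V k).
Proof.
exact: (measurable_wrt_fun (@innovation_measurable _ _ _ _ _ _ _ _ GV k)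
  (@innovation_adapted _ _ _ _ _ _ _ _ GV k)).
Qed.

Lemma measurable_run d' k : measurable_fun setT
  (fun z : config A * Omega => run d' k z.1 (path z.2)).
Proof.
elim: d' k => [|d' IH] k; first exact: measurable_fst.
have H : measurable_fun setT (fun z : config A * Omega =>
    (run d' k.+1 z.1 (path z.2), V k z.2)).
  by apply: measurable_fun_pair => //; exact: (measurableT_comp (mV k) measurable_snd).
exact: (measurableT_comp (measurable_kstep nu_iid p_gt0 k) H).
Qed.

(** The innovation being independent of the current configuration, each step
    moves the law by the kernel. *)
Lemma run_law d' k B : measurable B ->
  (mu \x P)%E [set z | B (run d' k z.1 (path z.2))] = mu B.
Proof.
elim: d' k B => [|d' IH] k B mB.
  transitivity ((mu \x P)%E (B `*` [set: Omega])).
    by congr ((mu \x P)%E _); apply/seteqP; split=> -[x w] //= [].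
  rewrite product_measure1E //.
  rewrite [X in (_ * X)%E](_ : _ = 1%E) ?mule1 //; exact: probability_setT.
pose S : set (config A * config A) := [set z | B (kstep k z.1 z.2)].
have mS : measurable S.
  by rewrite -[X in measurable X]setTI; exact: measurable_kstep.
pose Z (z : config A * Omega) := run d' k.+1 z.1 (path z.2).
pose Vk (z : config A * Omega) := V k z.2.
have mZ : measurable_fun setT Z by exact: measurable_run.
have mVk : measurable_fun setT Vk by exact: (measurableT_comp (mV k) measurable_snd).
transitivity ((mu \x P)%E [set z | S (Z z, Vk z)]) => //.
rewrite (@freeze _ _ _ (mu \x P)%E _ _ _ _ nu Z Vk) //; last first.
  move=> B1 B2 mB1 mB2.
  transitivity (\int[mu]_x P (xsection (Z @^-1` B1 `&` Vk @^-1` B2) x))%E => //.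
  transitivity ((\int[mu]_x P (xsection (Z @^-1` B1) x)) * nu B2)%E => //.
  rewrite -ge0_integralZr //; first last.
  - have mZB : measurable (Z @^-1` B1) by rewrite -[X in measurable X]setTI; exact: mZ.
    exact: measurable_fun_xsection.
  apply: eq_integral => x _.
  rewrite !xsectionE; apply: (innovation_indep GV) => //.
  exact: (run_adapted nu_iid p_gt0 GV).
pose Zf : {mfun (config A * Omega)%type >-> config A} :=
  HB.pack Z (isMeasurableFun.Build _ _ _ _ _ mZ).
transitivity (\int[distribution (mu \x P)%E Zf]_x tau_kernel nu x B)%E.
  rewrite (@ge0_integral_pushforward _ _ _ _ _ _ _ _ _ (fun x => tau_kernel nu x B)) //=.
  - by apply: eq_integral => z _; rewrite /= -(kstep_law nu_iid p_gt0 k) // xsectionE.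
  - exact: measurable_tau_kernel.
  - by move=> x _; exact: tau_kernel_ge0.
rewrite -[RHS]mu_invariant //; apply: eq_measure_integral => C mC _.
exact: IH.
Qed.

(** On the event that a recent block succeeds, the limit chain agrees near the
    origin with the chain started from mu. *)
Lemma chain_law k B : measurable B -> P (chain V k @^-1` B) = mu B.
Proof.
have mX : measurable_fun setT (chain V k) by exact: measurable_chain GV k.
pose Xf : {mfun Omega >-> config A} := HB.pack (chain V k) (isMeasurableFun.Build _ _ _ _ _ mX).
apply: (@config_probability_eq _ _ 0 (distribution P Xf) mu) => n y _.
change (P (chain V k @^-1` cyl n y) = mu (cyl n y)).
have mC : measurable (cyl n y : set (config A)) by exact: measurable_cyl.
have mXC : measurable (chain V k @^-1` cyl n y).
  by rewrite -[X in measurable X]setTI; exact: (mX measurableT _ mC).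
suff H e : 0 < e -> (P (chain V k @^-1` cyl n y) <= mu (cyl n y) + e%:E)%E /\
    (mu (cyl n y) <= P (chain V k @^-1` cyl n y) + e%:E)%E.
  apply/eqP; rewrite eq_le; apply/andP; split; apply/lee_addgt0Pr => e e0;
  by have [] := H e e0.
move=> e0; have [N NP] := harmonic_lt e0.
pose r := maxn N (maxn n k).
have kr : (k <= block_start (duration nu_iid p_gt0) r)%N.
  by have := leq_index_block_start dur_gt0 r; rewrite /r; lia.
have rr := block_start_lt dur_gt0 r.
pose d' := (block_start (duration nu_iid p_gt0) r.+1 - k)%N.
pose bad := [set w | ~ good (duration nu_iid p_gt0) r (path w)].
have mbad : measurable bad by exact: measurable_bad GV r.
have bade : (P bad <= e%:E)%E.
  apply: le_trans (bad_le nu_iid p_gt0 GV r) _; rewrite lee_fin ltW // NP //.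
  by rewrite /r leq_maxl.
pose E := [set z : config A * Omega | cyl n y (run d' k z.1 (path z.2))].
have QE : (mu \x P)%E E = mu (cyl n y) by exact: run_law.
have mE : measurable E.
  by rewrite -[X in measurable X]setTI; exact: measurable_run.
have QT (F : set Omega) : measurable F -> (mu \x P)%E (setT `*` F) = P F.
  move=> mF; rewrite product_measure1E //.
  rewrite [X in (X * _)%E](_ : _ = 1%E) ?mul1e //; exact: probability_setT.
have EX z : ~ bad z.2 -> E z <-> cyl n y (chain V k z.2).
  move=> /contrapT gz.
  have H i : (`|i| <= n)%N -> chain V k z.2 i = run d' k z.1 (path z.2) i.
    by move=> ik; apply: (@past_limit_good _ _ _ _ _ _ r) => //; lia.
  by split=> h i ik; [rewrite H //; exact: h|rewrite -H //; exact: h].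
have U2 (F1 F2 : set (config A * Omega)) : measurable F1 -> measurable F2 ->
    F1 `<=` F2 `|` (setT `*` bad) ->
    ((mu \x P) F1 <= (mu \x P) F2 + e%:E)%E.
  move=> mF1 mF2 F12; have mTb : measurable ([set: config A] `*` bad) by exact: measurableX.
  apply: (@le_trans _ _ ((mu \x P)%E (F2 `|` (setT `*` bad)))).
    by apply: le_measure; rewrite ?inE //; exact: measurableU.
  apply: le_trans (measureU2 _ _ _) _ => //.
  by apply: leeD2l; rewrite [leLHS](QT _ mbad).
have mTX : measurable ([set: config A] `*` (chain V k @^-1` cyl n y)).
  exact: measurableX.
split.
  have := U2 _ _ mTX mE; rewrite QT // QE; apply=> z [_ zX].
  by have [zb|zb] := pselect (bad z.2); [by right|left; exact/EX].
have := U2 _ _ mE mTX; rewrite QT // QE; apply=> z zE.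
by have [zb|zb] := pselect (bad z.2); [by right|left; split=> //; exact/EX].
Qed.

End Stationary.

(** * Markov chains are determined by one marginal and the kernel *)

Section SameLaw.
Variables (R : realType) (A : finZmodType).
Variable nu : probability (config A) R.
Local Notation paths := (trajectories (fun _ : nat => config A)).

(** The d'.+1 configurations from time -(k + d') to time -k, the oldest one being
    repeated for ever: finite stretches of all lengths are thus compared on one
    space of trajectories. *)
Definition stretch d' (X : nat -> config A) k : paths := fun i => X (k + minn i d')%N.

Lemma stretchS d' X k :
  stretch d'.+1 X k = path_cons (X k) (stretch d' X k.+1).
Proof.
apply/funext => -[|i]; rewrite /stretch /=; first by rewrite min0n addn0.
by rewrite minnSS addSnnS.
Qed.

Lemma measurable_stretch d (Omega : measurableType d) (X : nat -> Omega -> config A) d' k :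
  (forall i, measurable_fun setT (X i)) ->
  measurable_fun setT (fun w => stretch d' (fun i => X i w) k).
Proof. by move=> mX; apply: measurable_fun_paths => i; exact: mX. Qed.

Record markov_chain d (Omega : measurableType d) (P : probability Omega R)
    (mu : probability (config A) R) (X : nat -> Omega -> config A) : Prop := Markov {
  markov_measurable : forall k, measurable_fun setT (X k) ;
  markov_marginal : forall k B, measurable B -> P (X k @^-1` B) = mu B ;
  markov_kernel : forall d' k B S, measurable B -> measurable S ->
    P (X k @^-1` B `&` (fun w => stretch d' (fun i => X i w) k.+1) @^-1` S) =
    (\int[P]_(w in (fun w => stretch d' (fun i => X i w) k.+1) @^-1` S)
       tau_kernel nu (X k.+1 w) B)%E }.

Lemma paths_eq (m1 m2 : probability paths R) (H : set (set paths)) :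
  H `<=` measurable -> setI_closed H ->
  (forall i B, measurable B -> <<s H >> [set x : paths | B (x i)]) ->
  (forall S, H S -> m1 S = m2 S) -> forall S, measurable S -> m1 S = m2 S.
Proof.
move=> Hm HI Hgen m12 S mS; have m1T : m1 setT = 1%E := probability_setT m1.
have m2T : m2 setT = 1%E := probability_setT m2.
apply: (@pi_measure_eq _ _ _ H m1 m2) => //.
- by rewrite [X in (X < _)%E]m1T ltry.
- by rewrite [LHS]m1T [RHS]m2T.
move: S mS; apply: smallest_sub => [|_ [i _ [B mB <-]]].
  exact: smallest_sigma_algebra.
by rewrite setTI; exact: Hgen.
Qed.

Context d1 (Omega1 : measurableType d1) (P1 : probability Omega1 R).
Context d2 (Omega2 : measurableType d2) (P2 : probability Omega2 R).
Variable mu : probability (config A) R.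
Variables (X1 : nat -> Omega1 -> config A) (X2 : nat -> Omega2 -> config A).
Hypotheses (M1 : markov_chain P1 mu X1) (M2 : markov_chain P2 mu X2).

Let st1 d' k w := stretch d' (fun i => X1 i w) k.
Let st2 d' k w := stretch d' (fun i => X2 i w) k.

Let mst1 d' k : measurable_fun setT (st1 d' k).
Proof. by apply: measurable_stretch => i; exact: (markov_measurable M1). Qed.

Let mst2 d' k : measurable_fun setT (st2 d' k).
Proof. by apply: measurable_stretch => i; exact: (markov_measurable M2). Qed.

Let law1 d' k : probability paths R :=
  distribution P1 (HB.pack (st1 d' k) (isMeasurableFun.Build _ _ _ _ _ (mst1 d' k)) : {mfun Omega1 >-> paths}).

Let law2 d' k : probability paths R :=
  distribution P2 (HB.pack (st2 d' k) (isMeasurableFun.Build _ _ _ _ _ (mst2 d' k)) : {mfun Omega2 >-> paths}).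

(** Induction on the length: the kernel integrates against the law of the
    previous stretch only. *)
Let stretch_law d' k S : measurable S -> law1 d' k S = law2 d' k S.
Proof.
elim: d' k S => [|d' IH] k S mS.
  pose S' : set (config A) := [set x | S (fun=> x)].
  have mS' : measurable S'.
    have H : measurable_fun setT (fun x : config A => (fun=> x) : paths).
      exact: measurable_fun_paths.
    by rewrite -[X in measurable X]setTI; exact: H.
  have E (X : nat -> config A) : stretch 0 X k = (fun=> X k).
    by apply/funext => i; rewrite /stretch minn0 addn0.
  transitivity (P1 (X1 k @^-1` S')).
    by congr (P1 _); apply/seteqP; split=> w; rewrite /preimage /= /st1 E.
  rewrite (markov_marginal M1) // -(markov_marginal M2 k) //.
  by congr (P2 _); apply/seteqP; split=> w; rewrite /preimage /= /st2 E.
pose shift (x : paths) : paths := fun i => x i.+1.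
have mshift : measurable_fun setT shift.
  by apply: measurable_fun_paths => i; exact: measurable_fun_coordinate.
pose H : set (set paths) := [set S | exists B S', [/\ measurable B, measurable S' &
  S = [set x | B (x 0%N)] `&` shift @^-1` S']].
move: S mS; apply: (@paths_eq _ _ H).
- move=> _ [B [S' [mB mS' ->]]]; apply: measurableI; first exact: measurable_coordinate.
  by rewrite -[X in measurable X]setTI; exact: mshift.
- move=> _ _ [B [S' [mB mS' ->]]] [C [T' [mC mT' ->]]].
  exists (B `&` C), (S' `&` T'); split; [exact: measurableI|exact: measurableI|].
  by rewrite preimage_setI setIACA.
- move=> i B mB; apply: sub_sigma_algebra; case: i => [|i].
    by exists B, setT; split=> //; rewrite preimage_setT setIT.
  exists setT, [set x | B (x i)]; split => //; first exact: measurable_coordinate.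
  by apply/seteqP; split=> x //= [].
move=> _ [B [S' [mB mS' ->]]].
have mk : measurable_fun S' (fun x : paths => tau_kernel nu (x 0%N) B).
  apply: measurable_funTS.
  exact: (measurableT_comp (measurable_tau_kernel nu mB) (@measurable_fun_coordinate A 0)).
have k0 : {in S', forall x : paths, (0 <= tau_kernel nu (x 0%N) B)%E}.
  by move=> x _; exact: tau_kernel_ge0.
transitivity (P1 (X1 k @^-1` B `&` st1 d' k.+1 @^-1` S')).
  by congr (P1 _); apply/funext => w; rewrite /preimage /= /st1 stretchS.
rewrite (markov_kernel M1) //.
transitivity (\int[law1 d' k.+1]_(x in S') tau_kernel nu (x 0%N) B)%E.
  rewrite ge0_integral_pushforward //.
  by apply: eq_integral => w _; rewrite /= /st1 /stretch min0n addn0.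
rewrite (@eq_measure_integral _ _ _ _ (law2 d' k.+1)); last by move=> C mC _; exact: IH.
transitivity (P2 (X2 k @^-1` B `&` st2 d' k.+1 @^-1` S')); last first.
  by congr (P2 _); apply/funext => w; rewrite /preimage /= /st2 stretchS.
rewrite (markov_kernel M2) // ge0_integral_pushforward //.
by apply: eq_integral => w _; rewrite /= /st2 /stretch min0n addn0.
Qed.

Let whole1 w : paths := fun i => X1 i w.
Let whole2 w : paths := fun i => X2 i w.

Let mw1 : measurable_fun setT whole1.
Proof. by apply: measurable_fun_paths => i; exact: (markov_measurable M1). Qed.

Let mw2 : measurable_fun setT whole2.
Proof. by apply: measurable_fun_paths => i; exact: (markov_measurable M2). Qed.

Lemma markov_same_law S : measurable S -> P1 (whole1 @^-1` S) = P2 (whole2 @^-1` S).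
Proof.
pose l1 : probability paths R :=
  distribution P1 (HB.pack whole1 (isMeasurableFun.Build _ _ _ _ _ mw1) : {mfun Omega1 >-> paths}).
pose l2 : probability paths R :=
  distribution P2 (HB.pack whole2 (isMeasurableFun.Build _ _ _ _ _ mw2) : {mfun Omega2 >-> paths}).
pose freeze d' (x : paths) : paths := stretch d' x 0.
have mf d' : measurable_fun setT (freeze d').
  by apply: measurable_fun_paths => i; exact: measurable_fun_coordinate.
pose H : set (set paths) := [set S | exists d' S', measurable S' /\
  S = freeze d' @^-1` S'].
apply: (@paths_eq l1 l2 H).
- by move=> _ [d' [S' [mS' ->]]]; rewrite -[X in measurable X]setTI; exact: mf.
- have ff d' d'' x : (d' <= d'')%N -> freeze d' (freeze d'' x) = freeze d' x.
    move=> dd; apply/funext => i; rewrite /freeze /stretch !add0n.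
    by congr x; lia.
  move=> _ _ [b [S1 [mS1 ->]]] [c [S2 [mS2 ->]]].
  exists (maxn b c), (freeze b @^-1` S1 `&` freeze c @^-1` S2); split.
    by apply: measurableI; rewrite -[X in measurable X]setTI; exact: mf.
  by apply/seteqP; split=> x; rewrite /preimage /= !ff ?leq_maxl ?leq_maxr.
- move=> i B mB; apply: sub_sigma_algebra; exists i, [set x | B (x i)].
  split; first exact: measurable_coordinate.
  by apply/seteqP; split=> x; rewrite /preimage /= /freeze /stretch minnn add0n.
- move=> _ [d' [S' [mS' ->]]]; exact: (@stretch_law d' 0).
Qed.

End SameLaw.

(** * Random variables as functions of a generating process *)

Section PolishApproximation.
Variables (R : realType) (S : polishMetricType R).

Lemma dense_sequence : exists s : nat -> S,
  forall (y : S) (e : R), 0 < e -> exists n, mdist (s n) y < e.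
Proof.
have [D /countable_injP[f finj] Dd] := @separable R S.
exists (fun n => xget point [set x | D x /\ f x = n]) => y e e0.
have [x [yx Dx]] : (interior (ball y e)) `&` D !=set0.
  apply: Dd; last exact: open_interior.
  by exists y; apply/nbhs_ballP; exists e.
exists (f x); case: xgetP => [z _ [Dz fz]|/(_ x)[]//].
have -> : z = x by apply: finj; [exact: mem_set|exact: mem_set|exact: fz].
by rewrite metric_sym; have := interior_subset yx; rewrite ballEmdist.
Qed.

Lemma open_mdist_lt (s : S) (e : R) : open [set y | mdist s y < e].
Proof.
rewrite openE => y /= sy; apply/nbhs_ballP; exists (e - mdist s y).
  by rewrite /= subr_gt0.
move=> z; rewrite ballEmdist /= ltrBrDl => yz.
exact: le_lt_trans (metric_triangle _ y _) yz.
Qed.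

Variable u : nat -> S.
Hypothesis u_close : forall n, mdist (u n) (u n.+1) < 2 * (2 ^+ n)^-1.

Let close_add n k : mdist (u n) (u (n + k)%N) <= 4 * (2 ^+ n)^-1 - 4 * (2 ^+ (n + k))^-1.
Proof.
elim: k => [|k IH]; first by rewrite addn0 mdistxx subrr.
rewrite addnS; apply: le_trans (metric_triangle _ (u (n + k)%N) _) _.
apply: le_trans (lerD IH (ltW (u_close _))) _.
by rewrite [in X in _ <= X]exprS invfM; lra.
Qed.

Lemma close_cvg : exists l, forall n, mdist (u n) l <= 4 * (2 ^+ n)^-1.
Proof.
have pow_gt0 n : 0 < (2 ^+ n : R)^-1 by rewrite invr_gt0 exprn_gt0.
have H n m : (n <= m)%N -> mdist (u n) (u m) < 4 * (2 ^+ n)^-1.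
  move=> nm; rewrite -(subnKC nm); apply: le_lt_trans (close_add _ _) _.
  by rewrite gtrBl mulr_gt0.
have /cauchy_cvg ul : cauchy (u @ \oo).
  apply/cauchyP => e e0; have [N Ne] := exists_half_lt (divr_gt0 e0 (ltr0n R 4)).
  exists (u N), N => // m /= Nm; rewrite ballEmdist /=; apply: lt_trans (H _ _ Nm) _.
  by rewrite mulrC -ltr_pdivlMr.
exists (lim (u @ \oo)) => n; apply/ler_addgt0Pr => e e0.
have /cvg_ballP/(_ _ e0)[N _ NP] : u @ \oo --> lim (u @ \oo) by [].
have := NP (maxn n N) (leq_maxr _ _); rewrite ballEmdist /= => lu.
apply: le_trans (metric_triangle _ (u (maxn n N)) _) _; apply: lerD.
  by apply: ltW; apply: H; exact: leq_maxl.
by rewrite metric_sym; exact: ltW.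
Qed.

End PolishApproximation.

Section DoobDynkin.
Context (R : realType) d (Omega : measurableType d) (P : probability Omega R).
Context (I : Type) (dE : I -> measure_display).
Variables (E : forall i, measurableType (dE i)) (X : forall i, Omega -> E i).
Variables (S : polishMetricType R) (Y : Omega -> S).
Hypothesis mY : measurable_wrt (Sigma P X setT) (Y : Omega -> borel S).

Local Notation T := (trajectories E).

(** Y is the limit of countably valued approximations, taking the first point of
    a dense sequence that is close to Y; each of the events involved is, up to a
    null set, an event on the trajectory. *)
Lemma doob_dynkin : exists phi : T -> borel S, measurable_fun setT phi /\
  {ae P, forall w, Y w = phi (trajectory X w)}.
Proof.
have [s sP] := dense_sequence S.
have e0 n : 0 < (2 ^+ n : R)^-1 by rewrite invr_gt0 exprn_gt0.
pose U n i := [set y : S | mdist (s i) y < (2 ^+ n)^-1].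
have /choice[C CP] (ni : nat * nat) : exists C : set T, measurable C /\
    P.-negligible ((Y @^-1` U ni.1 ni.2) `+` (trajectory X @^-1` C)).
  have [|C mC CY] := @Sigma_trajectory _ _ _ P _ _ _ X (Y @^-1` U ni.1 ni.2).
    by apply: mY; apply: sub_sigma_algebra; exact: open_mdist_lt.
  by exists C.
(* On least n i, the n-th approximation takes the value s i. *)
pose least n i : set T := C (n, i) `\` \bigcup_(j in [set j | (j < i)%N]) C (n, j).
have mC n i : measurable (C (n, i)) by have [] := CP (n, i).
have mleast n i : measurable (least n i).
  by apply: measurableD => //; apply: bigcup_measurable => j _.
have least_uniq n i j x : least n i x -> least n j x -> i = j.
  move=> [xi ni] [xj nj]; case: (ltngtP i j) => // ij.
    by case: nj; exists i.
  by case: ni; exists j.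
(* Consecutive approximations of Y are this close; where the translated ones are
   too, they converge. *)
pose near2 n : set T := \bigcup_(ij in [set ij : nat * nat |
    mdist (s ij.1) (s ij.2) < 2 * (2 ^+ n)^-1]) (least n ij.1 `&` least n.+1 ij.2).
pose D : set T := \bigcap_n near2 n.
have mD : measurable D.
  apply: bigcapT_measurable => n.
  rewrite /near2 bigcup_mkcond; apply: countable_bigcupT_measurable => // ij.
  by case: ifP => // _; exact: measurableI.
pose approx n x := s (xget 0%N [set i | least n i x]).
have approxE n i x : least n i x -> approx n x = s i.
  move=> xi; rewrite /approx; congr s; apply: xget_unique => // j xj.
  exact: least_uniq xj xi.
have /choice[lim limP] (x : T) : exists l, D x ->
    forall n, mdist (approx n x) l <= 4 * (2 ^+ n)^-1.
  have [Dx|nDx] := pselect (D x); last by exists point.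
  have [|l lP] := @close_cvg R S (approx^~ x); last by exists l.
  move=> n; have [[i j] /= ij [xi xj]] := Dx n Logic.I.
  by rewrite (approxE _ _ _ xi) (approxE _ _ _ xj).
(* An approximation lies within 4 * 2^-n of the limit, hence a ball of radius
   5 * 2^-n around it contains the limit and stays within 9 * 2^-n of it. *)
have e_small (e : R) : 0 < e -> exists n, 9 * (2 ^+ n)^-1 < e.
  move=> ee; have [n ne] := exists_half_lt (divr_gt0 ee (ltr0n R 9)).
  by exists n; rewrite mulrC -ltr_pdivlMr.
pose phi (x : T) : borel S := if pselect (D x) then lim x else point.
exists phi; split.
  have openphi (O : set S) : open O -> measurable (phi @^-1` O).
    move=> Oop; rewrite (_ : phi @^-1` O =
      (\bigcup_(ni in [set ni : nat * nat | [set y : S | mdist (s ni.2) y < 5 * (2 ^+ ni.1)^-1] `<=` O])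
         (D `&` least ni.1 ni.2)) `|` (~` D `&` [set x | O point])).
      apply: measurableU.
        rewrite bigcup_mkcond; apply: countable_bigcupT_measurable => // ni.
        by case: ifP => // _; exact: measurableI.
      apply: measurableI; first exact: measurableC.
      have [Op|nOp] := pselect (O point).
        by rewrite (_ : [set _ | _] = setT) //; apply/seteqP; split.
      by rewrite (_ : [set _ | _] = set0) //; apply/seteqP; split.
    apply/seteqP; split=> x; rewrite /preimage /= /phi.
      case: pselect => Dx Ox; last by right.
      left; have : nbhs (lim x) O by exact: open_nbhs_nbhs.
      move=> /nbhs_ballP[e /= ee eO]; have [n ne] := e_small e ee.
      have [[i j] /= ij [xi xj]] := Dx n Logic.I.
      exists (n, i) => //= y siy; apply: eO; rewrite ballEmdist /=.
      apply: le_lt_trans (metric_triangle _ (s i) _) _.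
      have := limP x Dx n; rewrite (approxE _ _ _ xi) metric_sym => h.
      by apply: le_lt_trans (lerD h (ltW siy)) _; rewrite -mulrDl; lra.
    move=> [[[n i] /= sO [Dx xi]]|[nDx Op]]; last by case: pselect.
    case: pselect => [Dx'|//]; apply: sO; rewrite /=.
    have := limP x Dx n; rewrite (approxE _ _ _ xi) => h.
    by apply: le_lt_trans h _; rewrite ltr_pM2r // ltr_nat.
  apply: (@measurability _ _ _ _ _ phi (@open S)) => //.
  by move=> B [U' U'open <-]; rewrite setTI; exact: openphi.
pose N := \bigcup_(ni : nat * nat) ((Y @^-1` U ni.1 ni.2) `+` (trajectory X @^-1` C ni)).
have N0 : P.-negligible N.
  pose M k := if choice.unpickle k is Some ni
    then (Y @^-1` U ni.1 ni.2) `+` (trajectory X @^-1` C ni) else set0.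
  have M0 k : P.-negligible (M k).
    by rewrite /M; case: choice.unpickle => [ni|];
      [have [] := CP ni|exact: negligible_set0].
  have := negligible_bigcup M0; apply: negligibleS => w [ni _ Nw].
  by exists (choice.pickle ni) => //; rewrite /M choice.pickleK.
apply: negligibleS N0 => w /= Yw; apply: contrapT => nN; apply: Yw.
pose x : T := trajectory X w.
have UC n i : U n i (Y w) <-> C (n, i) x.
  split=> h; apply: contrapT => h'; apply: nN; exists (n, i) => //; first by left.
  by right.
have leastY n : exists2 i, least n i x & mdist (s i) (Y w) < (2 ^+ n)^-1.
  have ex : exists i, `[< U n i (Y w) >].
    by have [i iY] := sP (Y w) _ (e0 n); exists i; apply/asboolP.
  case: (ex_minnP ex) => i /asboolP Ui i_min; exists i => //.
  split; first exact/UC.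
  by move=> [j /= ji /UC Uj]; have := i_min j (asboolT Uj); rewrite leqNgt ji.
have Dx : D x.
  move=> n _; have [i xi iY] := leastY n; have [j xj jY] := leastY n.+1.
  exists (i, j) => //=; apply: le_lt_trans (metric_triangle _ (Y w) _) _.
  rewrite (_ : 2 * _ = (2 ^+ n)^-1 + (2 ^+ n)^-1); last by lra.
  apply: ltrD => //; rewrite metric_sym.
  apply: lt_le_trans jY _; rewrite lef_pV2 ?posrE ?exprn_gt0 //.
  by rewrite ler_eXn2l ?ltr1n.
rewrite /phi; case: pselect => // Dx'; apply: mdist_positivity.
apply/eqP; rewrite eq_le mdist_ge0 andbT; apply/ler_addgt0Pl => e ee.
have [n ne] := e_small e ee; rewrite addr0; have [i xi iY] := leastY n.
apply: le_trans (metric_triangle _ (s i) _) _.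
have := limP x Dx n; rewrite (approxE _ _ _ xi) => h.
rewrite metric_sym; apply: ltW; apply: lt_trans ne.
by apply: lt_le_trans (ltr_leD iY h) _; have := e0 n; lra.
Qed.

End DoobDynkin.

(** * Independent innovations on one probability space *)

Section IndependentSigma.
Context (R : realType) d (Omega : measurableType d) (P : probability Omega R).

Lemma independent_pi_l (G : set (set Omega)) (B : set Omega) :
  G `<=` measurable -> setI_closed G -> measurable B ->
  (forall A, G A -> P (A `&` B) = (P A * P B)%E) ->
  forall A, <<s G >> A -> P (A `&` B) = (P A * P B)%E.
Proof.
move=> Gm GI mB GB A GA.
have Bf : P B \is a fin_num by exact: fin_num_measure.
have B0 : 0 <= fine (P B) by exact: fine_ge0.
transitivity (mrestr P mB A) => //.
transitivity (mscale (NngNum B0) P A); last by rewrite /mscale /= fineK // muleC.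
apply: (@pi_measure_eq _ _ _ G) => //.
- rewrite /= /mrestr setTI; apply: le_lt_trans (ltry 1); exact: probability_le1.
- rewrite /= /mrestr /mscale setTI /= fineK //.
  by rewrite [X in (_ * X)%E](_ : _ = 1%E) ?mule1 //; exact: probability_setT.
by move=> C GC; rewrite /= /mrestr /mscale /= fineK // muleC GB.
Qed.

Lemma independent_pi (G1 G2 : set (set Omega)) :
  G1 `<=` measurable -> setI_closed G1 -> G2 `<=` measurable -> setI_closed G2 ->
  (forall A B, G1 A -> G2 B -> P (A `&` B) = (P A * P B)%E) ->
  forall A B, <<s G1 >> A -> <<s G2 >> B -> P (A `&` B) = (P A * P B)%E.
Proof.
move=> G1m G1I G2m G2I G12 A B G1A G2B.
have mA : measurable A.
  by move: A G1A; apply: smallest_sub => //; exact: sigma_algebra_measurable.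
rewrite setIC muleC; apply: (@independent_pi_l G2) => // C GC.
rewrite setIC muleC; apply: (@independent_pi_l G1) => //; first exact: G2m.
by move=> D GD; exact: G12.
Qed.

Context (I : choiceType) (dE : I -> measure_display).
Variables (E : forall i, measurableType (dE i)) (X : forall i, Omega -> E i).
Hypothesis mX : forall i, measurable_fun setT (X i).
Hypothesis Xind : mutually_independent P X.
Hypothesis Pcomplete : measure_is_complete P.

Definition finite_cylinders (J : set I) : set (set Omega) :=
  [set C | exists (F : {fset I}) (B : forall i, set (E i)),
    [/\ [set` F] `<=` J, forall i, measurable (B i) &
        C = \bigcap_(i in [set` F]) X i @^-1` B i]].

Let mXB i (B : set (E i)) : measurable B -> measurable (X i @^-1` B).
Proof. by move=> mB; rewrite -[X in measurable X]setTI; exact: mX. Qed.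

Let finite_cylinders_measurable J : finite_cylinders J `<=` measurable.
Proof.
move=> _ [F [B [_ mB ->]]]; apply: fin_bigcap_measurable => // i _; exact: mXB.
Qed.

Let cylinder_merge (F1 F2 : {fset I}) (B1 B2 : forall i, set (E i)) :
  (\bigcap_(i in [set` F1]) X i @^-1` B1 i) `&`
  (\bigcap_(i in [set` F2]) X i @^-1` B2 i) =
  \bigcap_(i in [set` (F1 `|` F2)%fset]) X i @^-1`
    ((if i \in F1 then B1 i else setT) `&` (if i \in F2 then B2 i else setT)).
Proof.
apply/seteqP; split=> w.
  by move=> [h1 h2] i /= _; split; case: ifPn => // iF; [exact: h1|exact: h2].
move=> h; split=> i /= iF.
  by have [|+ _] := h i; rewrite /= ?inE ?iF.
by have [|_] := h i; rewrite /= ?inE ?iF ?orbT.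
Qed.

Let finite_cylinders_setI J : setI_closed (finite_cylinders J).
Proof.
move=> _ _ [F1 [B1 [F1J mB1 ->]]] [F2 [B2 [F2J mB2 ->]]].
rewrite cylinder_merge; exists (F1 `|` F2)%fset; eexists; split; last reflexivity.
  by move=> i /=; rewrite inE => /orP[/F1J|/F2J].
by move=> i; apply: measurableI; case: ifP.
Qed.

Let cylinder_prob (F : {fset I}) (B : forall i, set (E i)) :
  (forall i, measurable (B i)) ->
  P (\bigcap_(i in [set` F]) X i @^-1` B i) = (\prod_(i <- F) P (X i @^-1` B i))%E.
Proof. by move=> mB; exact: Xind. Qed.

Let finite_cylinders_independent J1 J2 C1 C2 : J1 `&` J2 = set0 ->
  finite_cylinders J1 C1 -> finite_cylinders J2 C2 ->
  P (C1 `&` C2) = (P C1 * P C2)%E.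
Proof.
move=> J12 [F1 [B1 [F1J mB1 ->]]] [F2 [B2 [F2J mB2 ->]]].
have dis i : i \in F1 -> i \notin F2.
  move=> i1; apply/negP => i2; suff : (set0 : set I) i by [].
  by rewrite -J12; split; [exact: F1J|exact: F2J].
rewrite cylinder_merge !cylinder_prob //; last first.
  by move=> i; apply: measurableI; case: ifP.
rewrite (perm_big (enum_fset F1 ++ enum_fset F2)) /=; last first.
  apply: uniq_perm; first exact: fset_uniq.
    rewrite cat_uniq !fset_uniq andbT /=; apply/hasPn => i i2.
    by apply/negP => /dis /negP; apply.
  by move=> i; rewrite mem_cat !inE.
rewrite big_cat /=; congr (_ * _)%E.
  rewrite big_seq [RHS]big_seq; apply: eq_bigr => i i1.
  by rewrite (_ : i \in F1) // (negbTE (dis i i1)) setIT.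
rewrite big_seq [RHS]big_seq; apply: eq_bigr => i i2.
have /negbTE -> : i \notin F1 by apply/negP => /dis /negP; apply.
by rewrite (_ : i \in F2) // setTI.
Qed.

Let Sigma_cylinders J A : Sigma P X J A ->
  exists2 A', <<s finite_cylinders J >> A' & P.-negligible (A `+` A').
Proof.
move=> /negligible_sigma[A' GA' AA']; exists A' => //.
move: A' GA' {AA'}; apply: smallest_sub; first exact: smallest_sigma_algebra.
move=> _ [i Ji [B mB <-]]; rewrite setTI; apply: sub_sigma_algebra.
(* The event B of X i, as a family of events indexed by all the variables. *)
pose B' j : set (E j) := if pselect (i = j) is left ij then
  (fun y => B (eq_rect_r E y ij)) else setT.
have B'i : B' i = B.
  by rewrite /B'; case: pselect => // ii; rewrite (Prop_irrelevance ii erefl).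
exists [fset i]%fset, B'; split.
- by move=> j /=; rewrite inE => /eqP ->.
- move=> j; rewrite /B'; case: pselect => // ij; case: j / ij.
  by rewrite /eq_rect_r.
- apply/seteqP; split=> w.
    by move=> Bw j /=; rewrite inE => /eqP ->; rewrite B'i.
  by move=> /(_ i); rewrite B'i /= inE eqxx; apply.
Qed.

(** The finite cylinders over a set of indices are stable under intersection and
    generate its sigma-algebra up to null sets. *)
Lemma independent_Sigma J1 J2 : J1 `&` J2 = set0 ->
  independent P (Sigma P X J1) (Sigma P X J2).
Proof.
move=> J12 A B SA SB.
have mS J C : Sigma P X J C -> measurable C by apply: Sigma_measurable.
have mC J C : <<s finite_cylinders J >> C -> measurable C.
  by apply: smallest_sub => //; exact: sigma_algebra_measurable.
have [A' CA' AA'] := Sigma_cylinders SA; have [B' CB' BB'] := Sigma_cylinders SB.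
have mA := mS _ _ SA; have mB := mS _ _ SB.
have mA' := mC _ _ CA'; have mB' := mC _ _ CB'.
rewrite (negligible_setY_measure mA mA' AA') (negligible_setY_measure mB mB' BB').
rewrite -(independent_pi _ _ _ _ _ CA' CB') //; last first.
  by move=> C D; exact: finite_cylinders_independent.
apply: negligible_setY_measure; [exact: measurableI|exact: measurableI|].
apply: negligibleS (negligibleU AA' BB') => w [[[a b] n]|[[a b] n]].
  have [a'|a'] := pselect (A' w); last by left; left.
  by right; left; split=> // b'; apply: n.
have [a'|a'] := pselect (A w); last by left; right.
by right; right; split=> // b'; apply: n.
Qed.

End IndependentSigma.

Section Realization.
Variables (R : realType) (A : finZmodType) (p : A -> R).
Variable nu : probability (config A) R.
Hypothesis nu_iid : iid_coordinates p nu.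

Local Notation Om := (completed nu).
Local Notation Pr := (completion nu : probability Om R).

Definition place (k : nat) (i : int) : int := Posz (choice.pickle (k, i)).

Lemma place_inj k l i j : place k i = place l j -> k = l /\ i = j.
Proof. by move=> [/(pcan_inj choice.pickleK)[-> ->]]. Qed.

(** The letters of one configuration with law nu, dealt out into a sequence of
    independent configurations with the same law. *)
Definition deal (k : nat) : Om -> config A := fun w i => w (place k i).

Definition letter (i : int) : Om -> alphabet A := fun w => w i.

Lemma completion_nu (B : set (config A)) : measurable B -> Pr B = nu B.
Proof. exact: completion_measurable. Qed.

Lemma measurable_letter i : measurable_fun setT (letter i).
Proof. by apply: measurable_fun_completed; exact: measurable_fun_site. Qed.

Let measurable_deal0 k :
  measurable_fun setT (fun w : config A => (fun i => w (place k i)) : config A).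
Proof. by apply: measurable_fun_config => i; exact: measurable_fun_site. Qed.

Lemma measurable_deal k : measurable_fun setT (deal k).
Proof. by apply: measurable_fun_completed; exact: measurable_deal0. Qed.

Lemma letters_independent : mutually_independent Pr letter.
Proof.
move=> J B mB; have [ind _] := nu_iid.
have m1 i : measurable [set x : config A | B i (x i)] by exact: measurable_site.
transitivity (nu (\bigcap_(i in [set` J]) [set x : config A | B i (x i)])).
  apply: completion_nu; apply: fin_bigcap_measurable; first exact: finite_fset.
  by move=> i _; exact: m1.
rewrite [LHS]ind //; apply: eq_bigr => i _.
by symmetry; apply: completion_nu; exact: m1.
Qed.

Lemma deal_law k B : measurable B -> Pr (deal k @^-1` B) = nu B.
Proof.
move=> mB.
pose f : config A -> config A := fun w i => w (place k i).
have mf : measurable_fun setT f := measurable_deal0 k.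
pose ff : {mfun config A >-> config A} := HB.pack f (isMeasurableFun.Build _ _ _ _ _ mf).
transitivity (nu (f @^-1` B)).
  by apply: completion_nu; rewrite -[X in measurable X]setTI; exact: (mf measurableT).
apply: (@config_probability_eq _ _ 0 (distribution nu ff) nu) => // n y _.
transitivity (nu [set v : config A | forall j, j \in window n -> v (place k j) = y j]).
  by rewrite cyl_window.
rewrite (iid_sites nu_iid) ?uniq_window //; last by move=> i j _ _ /place_inj[].
by rewrite cyl_window (@iid_sites _ _ _ _ nu_iid _ id) ?uniq_window.
Qed.

Definition places (T : set nat) : set int :=
  [set l | exists k i, T k /\ l = place k i].

Lemma deal_letters T k : T k -> measurable_wrt (Sigma Pr letter (places T)) (deal k).
Proof.
move=> Tk; apply/(measurable_wrtP _ (Sigma_sigma_algebra _ _ _)).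
apply: measurable_fun_config => i.
apply/(measurable_wrtP _ (Sigma_sigma_algebra _ _ _)).
by apply: (@Sigma_coordinate _ _ _ Pr _ _ _ letter _ (place k i)); exists k, i.
Qed.

Lemma deal_complete : measure_is_complete Pr.
Proof. exact: completion_complete. Qed.

Lemma deal_independent T1 T2 : T1 `&` T2 = set0 ->
  independent Pr (Sigma Pr deal T1) (Sigma Pr deal T2).
Proof.
move=> T12.
have S T : Sigma Pr deal T `<=` Sigma Pr letter (places T).
  by apply: Sigma_sub => k; exact: deal_letters.
have H := @independent_Sigma _ _ _ Pr _ _ _ letter measurable_letter
  letters_independent deal_complete (places T1) (places T2).
move=> B C /S SB /S SC; apply: H => //; apply/seteqP; split=> // l.
move=> [[k [i [Tk ->]]] [k' [i' [Tk' /place_inj[kk _]]]]].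
suff : (set0 : set nat) k by [].
by rewrite -T12; split=> //; rewrite kk.
Qed.

Lemma deal_Sigma_measurable T : Sigma Pr deal T `<=` measurable.
Proof. by apply: Sigma_measurable => [|k _]; [exact: deal_complete|exact: measurable_deal]. Qed.

Lemma deal_mutually_independent : mutually_independent Pr deal.
Proof.
move=> J B mB.
suff H (s : seq nat) : uniq s ->
    Sigma Pr deal [set k | k \in s] (\bigcap_(k in [set k | k \in s]) deal k @^-1` B k) /\
    Pr (\bigcap_(k in [set k | k \in s]) deal k @^-1` B k) =
      (\prod_(k <- s) Pr (deal k @^-1` B k))%E.
  by have [_] := H (enum_fset J) (fset_uniq J).
elim: s => [_|k s IH /= /andP[ks us]].
  have -> : [set k : nat | k \in [::]] = set0 by apply/seteqP; split.
  rewrite bigcap_set0 big_nil; split; last exact: probability_setT.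
  have [h0 /(_ _ h0)] := Sigma_sigma_algebra Pr deal set0.
  by rewrite setD0.
have {IH}[IH1 IH2] := IH us.
have sub (T1 T2 : set nat) : T1 `<=` T2 -> Sigma Pr deal T1 `<=` Sigma Pr deal T2.
  exact: Sigma_mono.
have kE : [set k' | k' \in k :: s] = [set k] `|` [set k' | k' \in s].
  apply/seteqP; split=> l /=; rewrite inE.
    by move=> /orP[/eqP->|ls]; [left|right].
  by move=> [->|ls]; apply/orP; [left|right].
have Sk : Sigma Pr deal [set k] (deal k @^-1` B k).
  exact: (@Sigma_coordinate _ _ _ Pr _ _ _ deal [set k] k).
rewrite kE bigcap_setU bigcap_set1 big_cons -IH2; split; last first.
  apply: (deal_independent _ Sk IH1); apply/seteqP; split=> // l [-> /= ks'].
  by rewrite ks' in ks.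
have : measurable ((deal k @^-1` B k `&` \bigcap_(k in [set k | k \in s]) deal k @^-1` B k)
    : set (g_sigma_algebraType (Sigma Pr deal ([set k] `|` [set k' | k' \in s])))).
  apply: measurableI; apply: sub_sigma_algebra.
    by apply: sub Sk => l; left.
  by apply: sub IH1 => l; right.
by rewrite /measurable /= sigma_algebra_id //; exact: Sigma_sigma_algebra.
Qed.

Lemma deal_innovation (T : nat -> set nat) (a : nat -> nat) :
  (forall k, T k.+1 `<=` T k) -> (forall k, T k (a k)) ->
  (forall k, ~ T k.+1 (a k)) ->
  innovation nu Pr (fun k => Sigma Pr deal (T k)) (fun k => deal (a k)).
Proof.
move=> Tdec Ta nTa; split=> k.
- exact: Sigma_sigma_algebra.
- exact: deal_Sigma_measurable.
- exact: Sigma_mono.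
- exact: (@Sigma_coordinate _ _ _ Pr _ _ _ deal (T k) (a k)).
- move=> D B SD mB; rewrite -(deal_law (a k)) //.
  apply: (@deal_independent (T k.+1) [set a k]) => //.
    by apply/seteqP; split=> // l [Tl la]; apply: (nTa k); rewrite -la.
  exact: (@Sigma_coordinate _ _ _ Pr _ _ _ deal [set a k] (a k)).
Qed.

Lemma completion_polish : polish_probability Pr.
Proof.
exists (pconfig R A), (id : Om -> pconfig R A); split; first by exists id.
move=> B; split.
  move=> [B1 [B2 [m1 m2 s1 s2 e]]]; exists B1, B2; split=> //.
  - by rewrite borel_configE.
  - by rewrite borel_configE.
  - by rewrite preimage_id completion_nu //; exact: measurableD.
move=> [B1 [B2 [m1 m2 s1 s2 e]]]; exists B1, B2.
have mm1 : measurable (B1 : set (config A)) by rewrite -(borel_configE R).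
have mm2 : measurable (B2 : set (config A)) by rewrite -(borel_configE R).
split=> //; rewrite -completion_nu //; exact: measurableD.
Qed.

End Realization.

Arguments deal {R A} nu k w.

(** * Configurations as points of a Polish space *)

Section BorelConfigurations.
Variables (R : realType) (A : finZmodType).

Lemma Sigma_borel d (Omega : measurableType d) (P : probability Omega R) (I : Type)
    (X : I -> Omega -> config A) J :
  Sigma P (E := fun=> borel (pconfig R A)) X J = Sigma P X J.
Proof.
rewrite /Sigma; congr (<<s _ `|` _ >>); apply: eq_bigcupr => i _.
apply/seteqP; split=> _ [B mB <-]; exists B => //.
  by rewrite -(borel_configE R A).
by rewrite borel_configE.
Qed.

Lemma measurable_fun_borel d (T : measurableType d) (f : T -> config A) :
  measurable_fun setT f -> measurable_fun setT (f : T -> borel (pconfig R A)).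
Proof. by move=> mf mT B mB; apply: mf => //; rewrite -(borel_configE R A). Qed.

Lemma measurable_borel_trajectories :
  @measurable _ (trajectories (fun _ : nat => borel (pconfig R A))) =
  @measurable _ (trajectories (fun _ : nat => config A)).
Proof.
rewrite /measurable /=; congr (<<s _ >>); apply: eq_bigcupr => i _.
apply/seteqP; split=> _ [B mB <-]; exists B => //.
  by rewrite -(borel_configE R A).
by rewrite borel_configE.
Qed.

End BorelConfigurations.

Section Isomorphism.
Variables (R : realType) (A : finZmodType).
Variables (nu mu : probability (config A) R).
Context d1 (Omega1 : measurableType d1) (P1 : probability Omega1 R).
Context d2 (Omega2 : measurableType d2) (P2 : probability Omega2 R).
Variables (X1 : nat -> Omega1 -> config A) (X2 : nat -> Omega2 -> config A).
Hypotheses (M1 : markov_chain nu P1 mu X1) (M2 : markov_chain nu P2 mu X2).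

Lemma markov_isomorphic_via :
  isomorphic_via P1 P2 (E := fun=> pconfig R A)
    (fun k => Sigma P1 X1 [set m | (k <= m)%N])
    (fun k => Sigma P2 X2 [set m | (k <= m)%N]) X1 X2.
Proof.
split.
- split=> k; first exact/measurable_fun_borel/(markov_measurable M1).
  by rewrite Sigma_borel.
- split=> k; first exact/measurable_fun_borel/(markov_measurable M2).
  by rewrite Sigma_borel.
- move=> B; rewrite measurable_borel_trajectories => mB.
  exact: (markov_same_law M1 M2).
Qed.

End Isomorphism.

(** The stationary chain of the automaton, read backwards in time. *)
Section NegativeTime.
Variables (R : realType) (A : finZmodType).
Variables (nu mu : probability (config A) R).
Context d (Omega : measurableType d) (P : probability Omega R).
Variable X : int -> Omega -> config A.
Hypothesis hX : stationary_chain nu mu P X.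

Definition past_chain (k : nat) : Omega -> config A := X (- k%:Z).

Lemma negative_time_past k :
  negative_time_filtration P X k = Sigma P past_chain [set m | (k <= m)%N].
Proof.
rewrite /negative_time_filtration; apply/seteqP; split.
  apply: Sigma_sub => m /= mk.
  have -> : X m = past_chain `|m|%N by rewrite /past_chain; congr X; lia.
  by apply: (@Sigma_coordinate _ _ _ P _ _ _ past_chain) => /=; lia.
apply: Sigma_sub => m /= mk.
by apply: (@Sigma_coordinate _ _ _ P _ _ _ X _ (- m%:Z)) => /=; lia.
Qed.

Let tau_kernel_fin x B : measurable B -> tau_kernel nu x B \is a fin_num.
Proof.
move=> mB; apply: fin_num_measure; rewrite -[X in measurable X]setTI.
have H : measurable_fun setT (fun xi : config A => config_add (tau x) xi).
  by apply: measurable_config_add => //; exact: measurable_cst.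
exact: H.
Qed.

Lemma past_chain_markov : markov_chain nu P mu past_chain.
Proof.
have [mX margX kerX] := hX; split=> [k|k B|d' k B S] //; first exact: mX.
  exact: margX.
move=> mB mS.
set n : int := - k.+1%:Z; have n1 : n + 1 = - k%:Z by rewrite /n; lia.
have [_ _ /(_ _ _)kern] := kerX n B mB.
rewrite n1 in kern; rewrite -[LHS]kern.
  by apply: eq_integral => w _; rewrite fineK //; exact: tau_kernel_fin.
suff : measurable_wrt (Sigma P X [set m | m <= n])
    ((fun w => stretch d' (fun i => past_chain i w) k.+1) : Omega -> trajectories (fun _ : nat => config A)).
  by apply.
apply: (measurable_wrt_trajectory (X := fun i => past_chain (k.+1 + minn i d')%N)).
  exact: Sigma_sigma_algebra.
by move=> i; apply: (@Sigma_coordinate _ _ _ P _ _ _ X) => /=; rewrite /n; lia.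
Qed.

Lemma stationary_invariant B : measurable B ->
  (\int[mu]_x tau_kernel nu x B)%E = mu B.
Proof.
move=> mB; have [mX margX kerX] := hX.
have mk : measurable_fun setT (fun x => tau_kernel nu x B).
  exact: measurable_tau_kernel.
pose X0 : {mfun Omega >-> config A} := HB.pack (X 0) (isMeasurableFun.Build _ _ _ _ _ (mX 0)).
transitivity (\int[distribution P X0]_x tau_kernel nu x B)%E.
  by apply: eq_measure_integral => C mC _; apply/esym; exact: margX.
rewrite ge0_integral_pushforward //; last by move=> x _; exact: tau_kernel_ge0.
have [_ _ kern] := kerX 0 B mB.
rewrite -(margX (0 + 1) B mB) -[in RHS](setIT (_ @^-1` _)) -[RHS]kern.
  by apply: eq_integral => w _; rewrite /= fineK //; exact: tau_kernel_fin.
by have [h0 /(_ _ h0)] := Sigma_sigma_algebra P X [set m | m <= 0]; rewrite setD0.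
Qed.

End NegativeTime.

(** * Cosiness and standardness *)

Section Detection.
Context (R : realType) d (Omega : measurableType d) (P : probability Omega R).
Context d' (T : measurableType d').
Variables (f : Omega -> T) (g : nat -> Omega -> T).
Hypotheses (measurable_f : measurable_fun setT f)
  (measurable_g : forall N, measurable_fun setT (g N)).
Hypothesis fg_law : forall N S, measurable S -> P (f @^-1` S) = P (g N @^-1` S).

Definition differ N (S : set T) : set Omega :=
  (f @^-1` S) `+` (g N @^-1` S).

Definition detected (S : set T) : Prop := measurable S /\
  forall e : R, 0 < e -> exists N0, forall N, (N0 <= N)%N ->
    (P (differ N S) <= e%:E)%E.

Let mf S : measurable S -> measurable (f @^-1` S).
Proof. by move=> mS; rewrite -[X in measurable X]setTI; exact: measurable_f. Qed.

Let ms N S : measurable S -> measurable (g N @^-1` S).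
Proof. by move=> mS; rewrite -[X in measurable X]setTI; exact: measurable_g. Qed.

Let mdiffer N S : measurable S -> measurable (differ N S).
Proof.
by move=> mS; apply: measurableU; apply: measurableD; [exact: mf|exact: ms|exact: ms|exact: mf].
Qed.

Let PU (B C : set Omega) (b c : R) : measurable B -> measurable C ->
  (P B <= b%:E)%E -> (P C <= c%:E)%E -> (P (B `|` C) <= (b + c)%:E)%E.
Proof.
move=> mB mC Bb Cc; rewrite EFinD; apply: le_trans (leeD Bb Cc).
exact: measureU2.
Qed.

Let PS (B C : set Omega) : measurable B -> measurable C -> B `<=` C -> (P B <= P C)%E.
Proof. by move=> mB mC BC; apply: le_measure; rewrite ?inE. Qed.

Let detected_setC S : detected S -> detected (~` S).
Proof.
move=> [mS dS]; split; first exact: measurableC.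
move=> e e0; have [N0 NP] := dS e e0; exists N0 => N NN.
rewrite (_ : differ N (~` S) = differ N S); first exact: NP.
apply/seteqP; split=> w.
  move=> [[a b]|[a b]]; [right|left]; split; [exact: contrapT b|exact: a|
    exact: contrapT b|exact: a].
by move=> [[a b]|[a b]]; [right|left]; (split; [exact: b|move=> h; exact: (h a)]).
Qed.

Let detected_setU S S' : detected S -> detected S' -> detected (S `|` S').
Proof.
move=> [mS dS] [mS' dS']; split; first exact: measurableU.
move=> e e0; have e2 : 0 < e / 2 by rewrite divr_gt0.
have [N1 N1P] := dS _ e2; have [N2 N2P] := dS' _ e2.
exists (maxn N1 N2) => N; rewrite geq_max => /andP[NN1 NN2].
apply: (@le_trans _ _ (P (differ N S `|` differ N S'))).
  apply: PS; [by apply: mdiffer; exact: measurableU|by apply: measurableU; exact: mdiffer|].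
  move=> w [[[a|a] b]|[[a|a] b]].
  - by left; left; split=> // c; apply: b; left.
  - by right; left; split=> // c; apply: b; right.
  - by left; right; split=> // c; apply: b; left.
  - by right; right; split=> // c; apply: b; right.
rewrite [e]splitr; apply: PU; [exact: mdiffer|exact: mdiffer| |].
  exact: N1P.
exact: N2P.
Qed.

Let detected0 : detected set0.
Proof.
split=> // e e0; exists 0%N => N _; rewrite (_ : differ N set0 = set0) ?measure0 ?lee_fin ?ltW //.
by apply/seteqP; split=> // w [[]|[]].
Qed.

Let detected_bigsetU (F : (set T)^nat) n :
  (forall i, detected (F i)) -> detected (\big[setU/set0]_(i < n) F i).
Proof.
move=> dF; elim: n => [|n IH]; first by rewrite big_ord0.
by rewrite big_ord_recr /=; exact: detected_setU.
Qed.

Let tail_small (F : (set T)^nat) (e : R) : (forall i, measurable (F i)) -> 0 < e ->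
  exists n, (P (f @^-1` ((\bigcup_i F i) `\` \big[setU/set0]_(i < n) F i))
    <= e%:E)%E.
Proof.
move=> mF e0.
pose D n := f @^-1` ((\bigcup_i F i) `\` \big[setU/set0]_(i < n) F i).
have mD n : measurable (D n).
  apply: mf; apply: measurableD; first exact: bigcupT_measurable.
  exact: bigsetU_measurable.
have D0 : P (D n) @[n --> \oo] --> P (\bigcap_n D n).
  apply: nonincreasing_cvg_mu => //.
  - by apply: le_lt_trans (ltry 1); exact: probability_le1.
  - exact: bigcapT_measurable.
  - move=> m n mn; apply/subsetPset => w [a b]; split=> // c; apply: b.
    by move: c; rewrite -!bigcup_mkord => -[i /= im Fi]; exists i => //=; apply: leq_trans mn.
have Dcap : \bigcap_n D n = set0.
  apply/seteqP; split=> // w Dw; have [[i _ Fi] _] := Dw 0%N Logic.I.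
  have [_] := Dw i.+1 Logic.I; apply; rewrite -bigcup_mkord.
  by exists i => //=.
move: D0; rewrite Dcap measure0 => /fine_cvgP[Df /cvgrPdist_le/(_ e e0) De].
have [n [/= fn dn]] := filter_ex (filterI Df De).
exists n; rewrite -[X in (X <= _)%E]fineK // lee_fin.
by move: dn; rewrite sub0r normrN ger0_norm // fine_ge0.
Qed.

Let detected_bigcup (F : (set T)^nat) :
  (forall i, detected (F i)) -> detected (\bigcup_i F i).
Proof.
move=> dF; have mF i : measurable (F i) by case: (dF i).
have mU : measurable (\bigcup_i F i) by exact: bigcupT_measurable.
split=> // e e0; have e2 : 0 < e / 2 by rewrite divr_gt0.
have e4 : 0 < e / 2 / 2 by rewrite divr_gt0.
have [n nP] := tail_small mF e4; pose Sn := \big[setU/set0]_(i < n) F i.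
have [mSn dSn] : detected Sn by exact: detected_bigsetU.
have SnU : Sn `<=` \bigcup_i F i.
  by rewrite /Sn -bigcup_mkord => x [i _ Fi]; exists i.
have mTl : measurable ((\bigcup_i F i) `\` Sn) by exact: measurableD.
have [N0 NP] := dSn _ e2; exists N0 => N NN.
apply: (@le_trans _ _ (P (differ N Sn `|`
  (f @^-1` ((\bigcup_i F i) `\` Sn) `|`
   g N @^-1` ((\bigcup_i F i) `\` Sn))))).
  apply: PS; first exact: mdiffer.
    by apply: measurableU; [exact: mdiffer|apply: measurableU; [exact: mf|exact: ms]].
  move=> w [[a b]|[a b]].
    have [c|c] := pselect (Sn (f w)); last by right; left.
    by left; left; split=> // h; apply: b; exact: SnU.
  have [c|c] := pselect (Sn (g N w)); last by right; right.
  by left; right; split=> // h; apply: b; exact: SnU.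
rewrite [e]splitr; apply: PU; [exact: mdiffer| |exact: NP|].
  by apply: measurableU; [exact: mf|exact: ms].
rewrite [e / 2]splitr; apply: PU; [exact: mf|exact: ms|exact: nP|].
by rewrite -fg_law.
Qed.

Lemma detected_sigma_algebra : sigma_algebra setT detected.
Proof.
by split=> // S dS; rewrite setTD; exact: detected_setC.
Qed.

Lemma detected_intro S : measurable S ->
  (forall e : R, 0 < e -> exists (bad : set Omega) N0,
     [/\ measurable bad, (P bad <= e%:E)%E &
      forall N w, (N0 <= N)%N -> ~ bad w -> S (f w) <-> S (g N w)]) ->
  detected S.
Proof.
move=> mS H; split=> // e e0; have [bad [N0 [mbad bade fg]]] := H e e0.
exists N0 => N NN; apply: le_trans bade; apply: PS => //; first exact: mdiffer.
move=> w dw; apply: contrapT => wbad; have [h1 h2] := fg N w NN wbad.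
by case: dw => -[a b]; apply: b; [exact: h1|exact: h2].
Qed.

(** Finitely many small balls carry almost all the mass; detecting them brings
    the two copies of a Polish valued variable close to each other. *)
Lemma detected_close (S : polishMetricType R) (phi : T -> borel S) :
  measurable_fun setT phi -> measurable `<=` detected ->
  forall delta : R, 0 < delta -> exists N,
  ((1 - delta)%:E <
     P [set w | (mdist (phi (f w) : S) (phi (g N w) : S) < delta)%R])%E.
Proof.
move=> mphi det delta delta0.
have mphiB (U : set S) : open U -> measurable (phi @^-1` U).
  move=> Uo; rewrite -[X in measurable X]setTI; apply: mphi => //.
  exact: sub_sigma_algebra.
have [s sP] := dense_sequence S.
have d2 : 0 < delta / 2 by rewrite divr_gt0.
have d4 : 0 < delta / 2 / 2 by rewrite divr_gt0.
pose W i := phi @^-1` [set y : S | mdist (s i) y < delta / 2].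
have mW i : measurable (W i) by apply: mphiB; exact: open_mdist_lt.
have WT : \bigcup_i W i = setT.
  by apply/seteqP; split=> // x _; have [i ix] := sP (phi x) _ d2; exists i.
have [n nP] := tail_small mW d4; rewrite WT -bigcup_mkord in nP.
have [N0 NP] : exists N0, forall N, (N0 <= N)%N ->
    (P (\big[setU/set0]_(i < n) differ N (W i)) <= (delta / 2 / 2)%:E)%E.
  elim: n (delta / 2 / 2) d4 {nP} => [|n IH] e e0.
    by exists 0%N => N _; rewrite big_ord0 measure0 lee_fin ltW.
  have e2 : 0 < e / 2 by rewrite divr_gt0.
  have [N1 N1P] := IH _ e2; have [_ /(_ _ e2)[N2 N2P]] := det _ (mW n).
  exists (maxn N1 N2) => N; rewrite geq_max => /andP[NN1 NN2].
  rewrite big_ord_recr /= [e]splitr; apply: PU; [|exact: mdiffer|exact: N1P|exact: N2P].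
  by apply: bigsetU_measurable => i _; exact: mdiffer.
exists N0; set close := [set w | _].
(* A distance is less than delta as soon as some point of the dense sequence is
   within 2^-j of one point and within delta - 2^-j of the other one. *)
have mclose : measurable close.
  pose V1 i n := phi @^-1` [set y : S | mdist (s i) y < (2 ^+ n)^-1].
  pose V2 i n := phi @^-1` [set y : S | mdist (s i) y < delta - (2 ^+ n)^-1].
  rewrite (_ : close = \bigcup_(ij : nat * nat)
      (f @^-1` V1 ij.1 ij.2 `&` g N0 @^-1` V2 ij.1 ij.2)).
    apply: countable_bigcupT_measurable => // ij.
    by apply: measurableI; [apply: mf|apply: ms]; apply: mphiB; exact: open_mdist_lt.
  apply/seteqP; split=> w; last first.
    move=> [[i j] _ [h1 h2]]; rewrite /close /=.
    apply: le_lt_trans (metric_triangle _ (s i) _) _; rewrite metric_sym.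
    by move: h1 h2; rewrite /V1 /V2 /preimage /= => h1 h2; have := ltrD h1 h2; rewrite subrKC.
  rewrite /close /= => h; have d0 := h; rewrite -subr_gt0 in d0.
  have [j jd] := exists_half_lt (divr_gt0 d0 (ltr0n R 2)).
  have ej : 0 < (2 ^+ j : R)^-1 by rewrite invr_gt0 exprn_gt0.
  have [i ij] := sP (phi (f w)) _ ej.
  exists (i, j) => //; split=> //; rewrite /V2 /preimage /=.
  apply: le_lt_trans (metric_triangle _ (phi (f w) : S) _) _.
  by move: jd ij; rewrite ltr_pdivlMr // => jd ij; lra.
pose far := f @^-1` (setT `\` \bigcup_(i < n) W i) `|`
  \bigcup_(i < n) differ N0 (W i).
have mbig : measurable (\bigcup_(i < n) W i) by exact: bigcup_measurable.
have md : measurable (\bigcup_(i < n) differ N0 (W i)).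
  by apply: bigcup_measurable => i _; exact: mdiffer.
have mc : measurable (f @^-1` (setT `\` \bigcup_(i < n) W i)).
  by apply: mf; exact: measurableD.
have Pfar : (P far <= (delta / 2)%:E)%E.
  rewrite [delta / 2]splitr; apply: PU => //.
  by have := NP N0 (leqnn _); rewrite -(bigcup_mkord n (fun i => differ N0 (W i))).
have sub : ~` close `<=` far.
  move=> w nc; apply: contrapT => nf; apply: nc.
  have [i ilt Wi] : (\bigcup_(i < n) W i) (f w).
    by apply: contrapT => h; apply: nf; left.
  have Wi2 : W i (g N0 w).
    by apply: contrapT => h; apply: nf; right; exists i => //; left.
  rewrite /close /=; apply: le_lt_trans (metric_triangle _ (s i) _) _.
  by rewrite metric_sym [delta]splitr; exact: ltrD.
have Pc : (P (~` close) <= (delta / 2)%:E)%E.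
  by apply: le_trans Pfar; apply: PS => //; [exact: measurableC|exact: measurableU].
have Pcf : P close \is a fin_num by exact: fin_num_measure.
move: Pc; rewrite probability_setC // -(fineK Pcf) -EFinB lee_fin lte_fin => Pc.
by lra.
Qed.

End Detection.

Section Coupling.
Variables (R : realType) (A : finZmodType) (p : A -> R).
Variable nu : probability (config A) R.
Hypothesis nu_iid : iid_coordinates p nu.
Hypothesis p_gt0 : forall a, 0 < p a.
Variable mu : probability (config A) R.
Hypothesis mu_invariant : forall B, measurable B ->
  (\int[mu]_x tau_kernel nu x B)%E = mu B.

Local Notation chain := (chain nu_iid p_gt0).
Local Notation paths := (trajectories (fun _ : nat => config A)).

Lemma chain_markov d (Omega : measurableType d) (P : probability Omega R)
    (G : filtration Omega) (V : nat -> Omega -> config A) :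
  innovation nu P G V -> markov_chain nu P mu (chain V).
Proof.
move=> GV; split=> [k|k B mB|d' k B S mB mS].
- exact: measurable_chain GV k.
- exact: (chain_law nu_iid p_gt0 mu_invariant GV).
apply: (chain_kernel nu_iid p_gt0 GV) => //.
suff : measurable_wrt (G k.+1)
    ((fun w => stretch d' (fun i => chain V i w) k.+1) : Omega -> paths) by apply.
apply: (measurable_wrt_trajectory (X := fun i => chain V (k.+1 + minn i d')%N)).
  exact: (innovation_sigma GV).
move=> i C mC; apply: (innovation_mono GV (leq_addr (minn i d') k.+1)).
exact: (chain_adapted nu_iid p_gt0 GV).
Qed.

Lemma chain_Sigma d (Omega : measurableType d) (P : probability Omega R)
    (G : filtration Omega) (V : nat -> Omega -> config A) k :
  innovation nu P G V -> [set N | P.-negligible N] `<=` G k ->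
  Sigma P (chain V) [set m | (k <= m)%N] `<=` G k.
Proof.
move=> GV NG; apply: smallest_sub; first exact: (innovation_sigma GV).
move=> _ [/NG//|[i /= ki [B mB <-]]]; rewrite setTI.
apply: (innovation_mono GV ki); exact: (chain_adapted nu_iid p_gt0 GV).
Qed.

Local Notation Om := (completed nu).
Local Notation Pr := (completion nu : probability Om R).

(** The first chain reads the even innovations.  The second one reads the same
    during the last N steps, and the odd ones before. *)
Definition source (N k : nat) : nat := if (k < N)%N then k.*2 else k.*2.+1.

Definition first_chain : nat -> Om -> config A := chain (fun k => deal nu k.*2).

Definition second_chain N : nat -> Om -> config A :=
  chain (fun k => deal nu (source N k)).

Definition joint_past : filtration Om :=
  fun k => Sigma Pr (deal nu) [set m | (k.*2 <= m)%N].

Lemma first_innovation : innovation nu Pr joint_past (fun k => deal nu k.*2).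
Proof.
apply: (deal_innovation nu_iid) => k /=; [|exact: leqnn|].
  by move=> m /=; apply: leq_trans; rewrite leq_double.
by rewrite doubleS; lia.
Qed.

Lemma second_innovation N :
  innovation nu Pr joint_past (fun k => deal nu (source N k)).
Proof.
apply: (deal_innovation nu_iid) => k /=.
- by move=> m /=; apply: leq_trans; rewrite leq_double.
- by rewrite /source; case: ifP => _ //; exact: leqnSn.
- by rewrite /source doubleS; case: ifP => _; lia.
Qed.

Definition first_path (w : Om) : paths := fun k => first_chain k w.
Definition second_path N (w : Om) : paths := fun k => second_chain N k w.

Lemma measurable_first_path : measurable_fun setT first_path.
Proof.
apply: measurable_fun_paths => k.
exact: (measurable_chain nu_iid p_gt0 first_innovation).
Qed.

Lemma measurable_second_path N : measurable_fun setT (second_path N).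
Proof.
apply: measurable_fun_paths => k.
exact: (measurable_chain nu_iid p_gt0 (second_innovation N)).
Qed.

Lemma paths_same_law N S : measurable S ->
  Pr (first_path @^-1` S) = Pr (second_path N @^-1` S).
Proof.
move=> mS; exact: (markov_same_law (chain_markov first_innovation)
  (chain_markov (second_innovation N)) mS).
Qed.

(** Up to the beginning of block r both chains read the same innovations, and the
    success of this block makes them forget what came before. *)
Lemma chains_agree N k j r w :
  good (duration nu_iid p_gt0) r (fun k => deal nu k.*2 w) ->
  (maxn k `|j|%N <= r)%N -> (block_start (duration nu_iid p_gt0) r.+1 <= N)%N ->
  first_chain k w j = second_chain N k w j.
Proof.
set dur := duration nu_iid p_gt0; move=> gw kjr NN.
have kr : (k <= block_start dur r)%N.
  by have := leq_index_block_start (duration_gt0 nu_iid p_gt0) r; rewrite /dur; lia.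
have rr := block_start_lt (duration_gt0 nu_iid p_gt0) r.
pose d := (block_start dur r.+1 - k)%N.
have kd : (block_start dur r.+1 <= k + d)%N by rewrite /d; lia.
have jr : (`|j| <= r)%N by lia.
have com i : (i < block_start dur r.+1)%N -> deal nu i.*2 w = deal nu (source N i) w.
  by move=> ir; rewrite /source (leq_trans ir NN).
have gw2 := good_eq com gw.
transitivity (run (duration_gt0 nu_iid p_gt0) d k (fun=> 0) (fun k => deal nu k.*2 w) j).
  exact: past_limit_good gw kr kd jr.
transitivity (run (duration_gt0 nu_iid p_gt0) d k (fun=> 0)
    (fun k => deal nu (source N k) w) j); last first.
  by apply: esym; exact: past_limit_good gw2 kr kd jr.
rewrite (@run_eq _ _ (duration_gt0 nu_iid p_gt0) d k (fun=> 0) _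
  (fun k => deal nu (source N k) w)) //.
by move=> i ik; apply: com; move: ik; rewrite /d; lia.
Qed.

Lemma chains_detected : measurable `<=` detected Pr first_path second_path.
Proof.
have sD := detected_sigma_algebra measurable_first_path measurable_second_path paths_same_law.
have [D0 DC DU] := sD.
have site k j (B : set (alphabet A)) :
    detected Pr first_path second_path [set x : paths | B (x k j)].
  apply: (detected_intro measurable_first_path measurable_second_path).
    exact: (@measurable_coordinate A k _ (measurable_site j B)).
  move=> e e0; have [r0 rP] := harmonic_lt e0.
  pose r := maxn r0 (maxn k `|j|%N).
  exists [set w : Om | ~ good (duration nu_iid p_gt0) r (fun k => deal nu k.*2 w)],
    (block_start (duration nu_iid p_gt0) r.+1); split.
  - exact: measurable_bad first_innovation r.
  - apply: le_trans (bad_le nu_iid p_gt0 first_innovation r) _.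
    by rewrite lee_fin ltW // rP // leq_maxl.
  - move=> N w NN /contrapT gw; rewrite /first_path /second_path /=.
    by rewrite (@chains_agree N k j r w gw) // leq_maxr.
apply: smallest_sub => // _ [k _ [B mB <-]]; rewrite setTI.
move: B mB; apply: smallest_sub.
  split=> [|B /DC|F /DU] /=; [exact: D0|exact|by rewrite preimage_bigcup].
by move=> _ [j _ [B mB <-]]; rewrite setTI; exact: site.
Qed.

End Coupling.

Section Conclusion.
Variables (R : realType) (A : finZmodType) (p : A -> R).
Variable nu : probability (config A) R.
Hypothesis nu_iid : iid_coordinates p nu.
Hypothesis p_gt0 : forall a, 0 < p a.
Variable mu : probability (config A) R.
Context d (Omega : measurableType d) (P : probability Omega R).
Variable X : int -> Omega -> config A.
Hypothesis hX : stationary_chain nu mu P X.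

Local Notation chain := (chain nu_iid p_gt0).
Local Notation paths := (trajectories (fun _ : nat => config A)).
Local Notation Om := (completed nu).
Local Notation Pr := (completion nu : probability Om R).
Local Notation past_of Z := (fun k => Sigma Pr Z [set m | (k <= m)%N]).

Let inv B : measurable B -> (\int[mu]_x tau_kernel nu x B)%E = mu B.
Proof. exact: (stationary_invariant hX). Qed.

Let pastE : negative_time_filtration P X =
  (fun k => Sigma P (past_chain X) [set m | (k <= m)%N]).
Proof. by apply/funext => k; exact: negative_time_past. Qed.

Let past_chain_Sigma (J : nat -> set nat) V :
  innovation nu Pr (fun k => Sigma Pr (deal nu) (J k)) V ->
  forall k, Sigma Pr (chain V) [set m | (k <= m)%N] `<=` Sigma Pr (deal nu) (J k).
Proof.
move=> GV k; apply: (@chain_Sigma _ _ _ _ nu_iid p_gt0 _ _ _ _ _ k GV).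
by move=> N nN; apply: sub_sigma_algebra; left.
Qed.

Lemma chain_isomorphic_via (G : filtration Om) V : innovation nu Pr G V ->
  isomorphic_via P Pr (E := fun=> pconfig R A)
    (negative_time_filtration P X) (past_of (chain V)) (past_chain X) (chain V).
Proof.
move=> GV; rewrite pastE; apply: markov_isomorphic_via (past_chain_markov hX) _.
exact: (chain_markov nu_iid p_gt0 inv GV).
Qed.

Lemma chain_isomorphic (G : filtration Om) V : innovation nu Pr G V ->
  isomorphic P Pr (negative_time_filtration P X) (past_of (chain V)).
Proof.
by move=> GV; eexists; eexists; eexists; exact: chain_isomorphic_via GV.
Qed.

(** The chain is immersed in the filtration of the innovations themselves. *)
Lemma automaton_standard : standard P (negative_time_filtration P X).
Proof.
pose T k : set nat := [set m | (k <= m)%N].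
have GV : innovation nu Pr (fun k => Sigma Pr (deal nu) (T k)) (deal nu).
  apply: (@deal_innovation _ _ _ _ nu_iid T id) => k; rewrite /T /=.
  - by move=> m /=; exact: ltnW.
  - exact: leqnn.
  - by rewrite ltnn.
exists default_measure_display, Om, Pr, (fun k => Sigma Pr (deal nu) (T k)).
split; first exact: completion_polish.
  exists (fun=> pconfig R A), (deal nu); split.
    split=> k; first exact/measurable_fun_borel/measurable_deal.
    by rewrite Sigma_borel.
  move=> J B mB; apply: (deal_mutually_independent nu_iid) => i.
  by rewrite -(borel_configE R A).
exists (past_of (chain (deal nu))); split; first exact: chain_isomorphic GV.
apply: (chain_immersed GV) => // k; [exact: Sigma_sigma_algebra|exact: subset_refl|].
exact: (@past_chain_Sigma T _ GV).
Qed.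

Local Notation first := (first_chain nu_iid p_gt0).
Local Notation second := (second_chain nu_iid p_gt0).
Local Notation joint := (@joint_past _ _ nu).

Let first_inno := first_innovation nu_iid.
Let second_inno N := second_innovation nu_iid N.

Let first_joint k : Sigma Pr first [set m | (k <= m)%N] `<=` joint k.
Proof.
exact: (@past_chain_Sigma (fun k => [set m | (k.*2 <= m)%N]) _ first_inno).
Qed.

Let second_joint N k : Sigma Pr (second N) [set m | (k <= m)%N] `<=` joint k.
Proof.
exact: (@past_chain_Sigma (fun k => [set m | (k.*2 <= m)%N]) _ (second_inno N)).
Qed.

(** Both chains are immersed in the filtration of all the innovations that either
    of them may read, hence in any smaller one that contains them. *)
Lemma coupling_real_time N : real_time_coupling P Pr
  (negative_time_filtration P X) (past_of first) (past_of (second N)).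
Proof.
have HG k : joinF (past_of first) (past_of (second N)) k `<=` joint k.
  apply: smallest_sub; first exact: Sigma_sigma_algebra.
  by move=> B [/first_joint|/second_joint].
split.
- exact: chain_isomorphic first_inno.
- exact: chain_isomorphic (second_inno N).
split.
  apply: (chain_immersed first_inno) => // k; first exact: smallest_sigma_algebra.
  by move=> B FB; apply: sub_sigma_algebra; left.
apply: (chain_immersed (second_inno N)) => // k; first exact: smallest_sigma_algebra.
by move=> B FB; apply: sub_sigma_algebra; right.
Qed.

(** Before time -N the second chain reads odd innovations only. *)
Lemma coupling_independent_past N :
  independent_in_distant_past Pr (past_of first) (past_of (second N)).
Proof.
exists N.
pose T1 k : set nat := [set l | exists2 m, (k <= m)%N & l = m.*2].
pose T2 k : set nat := [set l | exists2 m, (k <= m)%N & l = source N m].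
have odd_source m : (N <= m)%N -> odd (source N m).
  by rewrite /source ltnNge => -> /=; rewrite odd_double.
have source_inj m m' : source N m = source N m' -> m = m'.
  by rewrite /source; case: ifP; case: ifP; lia.
have I1 : innovation nu Pr (fun k => Sigma Pr (deal nu) (T1 k)) (fun k => deal nu k.*2).
  apply: (@deal_innovation _ _ _ _ nu_iid T1 double) => k.
  - by move=> _ [m km ->]; exists m => //; exact: ltnW.
  - by exists k.
  - by move=> [m km]; lia.
have I2 : innovation nu Pr (fun k => Sigma Pr (deal nu) (T2 k)) (fun k => deal nu (source N k)).
  apply: (@deal_innovation _ _ _ _ nu_iid T2 (source N)) => k.
  - by move=> _ [m km ->]; exists m => //; exact: ltnW.
  - by exists k.
  - by move=> [m km /source_inj]; lia.
move=> B C FB FC; apply: (@deal_independent _ _ _ _ nu_iid (T1 N) (T2 N)).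
- apply/seteqP; split=> // l [[m _ lm] [m' Nm' lm']].
  by have := odd_source m' Nm'; rewrite -lm' lm odd_double.
- exact: (@past_chain_Sigma T1 _ I1 N _ FB).
- exact: (@past_chain_Sigma T2 _ I2 N _ FC).
Qed.

Lemma automaton_I_cosy : I_cosy P (negative_time_filtration P X).
Proof.
move=> S Y mY delta delta0.
pose XB : nat -> Omega -> borel (pconfig R A) := past_chain X.
have mY' : measurable_wrt (Sigma P (E := fun=> borel (pconfig R A)) XB setT)
    (Y : Omega -> borel S).
  move=> B mB; have := mY B mB; rewrite negative_time_past Sigma_borel.
  by congr (Sigma P _ _ _); apply/seteqP; split.
have [phi [mphi Yphi]] := doob_dynkin mY'.
have mphi' (U : set (borel S)) : measurable U -> measurable (phi @^-1` U : set paths).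
  move=> mU; rewrite -(measurable_borel_trajectories R A).
  by rewrite -[X in measurable X]setTI; exact: mphi.
pose c1 (w : Om) : paths := fun k => first k w.
pose c2 N (w : Om) : paths := fun k => second N k w.
have mphiC : measurable_fun setT (phi : paths -> borel S).
  by move=> _ U mU; rewrite setTI; exact: mphi'.
have [N NP] := detected_close (measurable_first_path nu_iid p_gt0)
  (measurable_second_path nu_iid p_gt0) mphiC
  (chains_detected nu_iid p_gt0 inv) delta0.
exists default_measure_display, Om, Pr, (past_of first), (past_of (second N)),
  (fun w => phi (c1 w)), (fun w => phi (c2 N w)); split.
  split; [exact: completion_polish|exact: coupling_real_time|].
  exact: coupling_independent_past.
split; [| |exact: NP].
  exists (fun=> pconfig R A), (past_chain X), first, phi; split=> //.
  exact: chain_isomorphic_via first_inno.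
exists (fun=> pconfig R A), (past_chain X), (second N), phi; split=> //.
exact: chain_isomorphic_via (second_inno N).
Qed.

End Conclusion.

Theorem theorem2p13 (R : realType) (A : finZmodType) (hA : (2 <= #|A|)%N)
  (eps : R) (eps_gt0 : 0 < eps) (eps_lt : eps < (#|A|%:R - 1) / #|A|%:R)
  (nu : probability (config A) R) (hnu : iid_coordinates (noise_weight eps) nu)
  (mu : probability (config A) R)
  (hmu : iid_coordinates (@uniform_weight R A) mu)
  (d : measure_display) (Omega : measurableType d) (P : probability Omega R)
  (hP : polish_probability P) (X : int -> Omega -> config A)
  (hX : stationary_chain nu mu P X) :
  I_cosy P (negative_time_filtration P X) /\
  standard P (negative_time_filtration P X).
Proof.
have A1 : 1 < #|A|%:R :> R by rewrite ltr1n.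
have eps_lt1 : eps < 1.
  have A0 : 0 < #|A|%:R :> R := lt_trans ltr01 A1.
  apply: lt_le_trans eps_lt _; rewrite ler_pdivrMr // mul1r; lra.
have p_gt0 (a : A) : 0 < noise_weight eps a.
  rewrite /noise_weight; case: ifP => _; first by rewrite subr_gt0.
  by rewrite divr_gt0 // subr_gt0.
split; first exact: (automaton_I_cosy hnu p_gt0 hX).
exact: (automaton_standard hnu p_gt0 hX).
Qed.
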